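(* Consider the (possibly non-convex) quadratically constrained quadratic program (QCQP) $$\min_{z\in\mathbb{R}^k}\ \tfrac12 z^\top P_0 z+q_0^\top z\quad\text{s.t.}\quad \tfrac12 z^\top P_i z+q_i^\top z+r_i\le 0\ \ (i=1,\dots,m_I),\qquad \tfrac12 z^\top D_i z+h_i^\top z+g_i=0\ \ (i=1,\dots,m_E),$$ with parameters $P_0,P_i,D_i\in\mathbb{R}^{k\times k}$, $q_0,q_i,h_i\in\mathbb{R}^k$ and $r_i,g_i\in\mathbb{R}$. Let $z^*$ be the optimal solution, and let $\nu^*\in\mathbb{R}^{m_I}$ and $\lambda^*\in\mathbb{R}^{m_E}$ be the optimal dual variables associated with the inequality and equality constraints, respectively. Let $\ell:\mathbb{R}^k\to\mathbb{R}$ be a differentiable downstream loss function evaluated at $z^*$, and let $M\in\mathbb{R}^{(k+m_I+m_E)\times(k+m_I+m_E)}$ be the KKT differential matrix defined in the context. Suppose that strict complementary slackness, the linear (independence) constraint qualification and the second-order sufficient conditions hold at $(z^*,\nu^*,\lambda^* )$. Then the matrix $M$ is invertible and $\ell$ (that is, $\ell(z^* )$) is a differentiable function of the QCQP parameters. Given $\frac{\partial \ell}{\partial z^*}\in\mathbb{R}^k$, we have $$\nabla_{P_0}\ell=z^*d_z^\top,\qquad \nabla_{q_0}\ell=d_z,$$ for $i=1,\dots,m_I$, $$\nabla_{P_i}\ell=\nu_i^*z^*d_z^\top+\tfrac12\nu_i^*z^*(z^* )^\top d_{\nu_i},\qquad \nabla_{q_i}\ell=\nu_i^*d_z+z^*d_{\nu_i},\qquad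 \nabla_{r_i}\ell=d_{\nu_i},$$ and, for $i=1,\dots,m_E$, $$\nabla_{D_i}\ell=\lambda_i^*z^*d_z^\top+\tfrac12 d_{\lambda_i}z^*(z^* )^\top,\qquad \nabla_{h_i}\ell=\lambda_i^*d_z+z^*d_{\lambda_i},\qquad \nabla_{g_i}\ell=d_{\lambda_i},$$ where $d_z\in\mathbb{R}^k$, $d_\nu\in\mathbb{R}^{m_I}$, $d_\lambda\in\mathbb{R}^{m_E}$ (with components $d_{\nu_i}$, $d_{\lambda_i}$) are the solutions to $$\begin{bmatrix} d_z\\ d_\nu\\ d_\lambda\end{bmatrix}=-M^{-\top}\begin{bmatrix}\frac{\partial \ell}{\partial z^*}\\ 0\\ 0\end{bmatrix}.$$
   Context: **Notation.** Write $p_i(z)=\tfrac12 z^\top P_i z+q_i^\top z+r_i$ ($i=1,\dots,m_I$) and $c_i(z)=\tfrac12 z^\top D_i z+h_i^\top z+g_i$ ($i=1,\dots,m_E$). The Lagrangian is $L(z,\nu,\lambda)=\tfrac12 z^\top P_0z+q_0^\top z+\sum_{i=1}^{m_I}\nu_i p_i(z)+\sum_{i=1}^{m_E}\lambda_i c_i(z)$. **KKT conditions** at $(z^*,\nu^*,\lambda^* )$: $P_0z^*+q_0+\sum_{i=1}^{m_I}\nu_i^*(P_iz^*+q_i)+\sum_{i=1}^{m_E}\lambda_i^*(D_iz^*+h_i)=0$; $p_i(z^* )\le 0$, $\nu_i^*\ge 0$ and $\nu_i^*p_i(z^* )=0$ for $i=1,\dots,m_I$; $c_i(z^* )=0$ for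 $i=1,\dots,m_E$. **Hypotheses.** The active set is $\mathcal{A}(z^* )=\{i\in\{1,\dots,m_I\}:p_i(z^* )=0\}$. Strict complementary slackness: $\nu_i^*>0$ for all $i\in\mathcal{A}(z^* )$ and $\nu_i^*=0$ for all $i\notin\mathcal{A}(z^* )$. Constraint qualification: the matrix $K$ whose rows are the transposed gradients at $z^*$ of the active inequality constraints $p_i$, $i\in\mathcal{A}(z^* )$, and of all equality constraints $c_i$, $i=1,\dots,m_E$, has full row rank. Second-order sufficient conditions: the Hessian in $z$ of the Lagrangian at $(z^*,\nu^*,\lambda^* )$ is positive definite on the null space of $K$. **The matrix $M$.** In block form with block sizes $k$, $m_I$, $m_E$, $$M=\begin{bmatrix} M_{11} & M_{12} & M_{13}\\ M_{21} & M_{22} & 0\\ M_{31} & 0 & 0\end{bmatrix},$$ where $M_{11}=P_0+\sum_{i=1}^{m_I}\nu_i^*P_i+\sum_{i=1}^{m_E}\lambda_i^*D_i$; $M_{12}$ has $i$-th column $P_iz^*+q_i$; $M_{13}$ has $i$-th column $D_iz^*+h_i$; $M_{21}$ has $i$-th row $\nu_i^*\big(\tfrac12(z^* )^\top P_i^\top+\tfrac12(z^* )^\top P_i+q_i^\top\big)$; $M_{22}$ is diagonal with $i$-th diagonal entry $p_i(z^* )=\tfrac12(z^* )^\top P_iz^*+q_i^\top z^*+r_i$; and $M_{31}$ has $i$-th row $\tfrac12(z^* )^\top D_i^\top+\tfrac12(z^* )^\top D_i+h_i^\top$. **Dependence of $z^*$ on the parameters.** The QCQP is viewed as defining a mapping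 from its parameters to $z^*$: the KKT equalities are preserved at $(z^*,\nu^*,\lambda^* )$ under differential changes of the parameters, so that the differentials satisfy $$M\begin{bmatrix}dz^*\\ d\nu^*\\ d\lambda^*\end{bmatrix}=b,$$ where $b\in\mathbb{R}^{k+m_I+m_E}$ is minus the vector with first block $dP_0z^*+dq_0+\sum_{i=1}^{m_I}(\nu_i^*dP_iz^*+\nu_i^*dq_i)+\sum_{i=1}^{m_E}(\lambda_i^*dD_iz^*+\lambda_i^*dh_i)$, followed by the entries $\nu_i^*\big(\tfrac12(z^* )^\top dP_iz^*+dq_i^\top z^*+dr_i\big)$ for $i=1,\dots,m_I$, and then the entries $\tfrac12(z^* )^\top dD_iz^*+dh_i^\top z^*+dg_i$ for $i=1,\dots,m_E$.
   Formalization: Printed gradients for q_i, r_i (inequalities) are false; proved: ν_i d_z + ν_i d_{ν_i} z* and ν_i d_{ν_i}. P_0, P_i, D_i are assumed symmetric at the base point (else M may be singular); matrix gradients use the layout dℓ = tr(G dP), and z* is the local KKT branch. *)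

(* Defs.v *)
From HB Require Import structures.
From mathcomp Require Import all_boot all_order all_algebra.
From mathcomp Require Import all_classical all_reals all_analysis.
Set Implicit Arguments.
Unset Strict Implicit.
Unset Printing Implicit Defensive.
Import Order.TTheory GRing.Theory Num.Theory.
Import numFieldNormedType.Exports.
Local Open Scope classical_set_scope.
Local Open Scope ring_scope.

Section Calculus.
Variables (R : realType) (k : nat).

Definition grad (f : 'cV[R]_k -> R) (z : 'cV[R]_k) : 'cV[R]_k :=
  \col_i 'D_(delta_mx i 0) f z.

Definition hess (f : 'cV[R]_k -> R) (z : 'cV[R]_k) : 'M[R]_k :=
  \matrix_(i, j) 'D_(delta_mx j 0) (fun w => 'D_(delta_mx i 0) f w) z.

Definition scal (a : 'M[R]_1) : R := a 0 0.

Definition quad (P : 'M[R]_k) (q : 'cV[R]_k) (r : R) (z : 'cV[R]_k) : R :=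
  2^-1 * scal (z^T *m P *m z) + scal (q^T *m z) + r.

End Calculus.

Section QCQP.
Variables (R : realType) (k mI mE : nat).

(* The parameter tuple ((P0, q0), (P, q, r), (D, h, g)) as a point of a normed
   space.  Row i of the first component of (P, q, r) is the k x k matrix P_i
   flattened by mxvec, and row i of the second one is q_i^T; likewise for
   (D, h, g).  The matrices range over all k x k matrices. *)
Definition qcqp : normedModType R :=
  (('M[R]_k * 'cV[R]_k) *
   ('M[R]_(mI, k * k) * 'M[R]_(mI, k) * 'cV[R]_mI) *
   ('M[R]_(mE, k * k) * 'M[R]_(mE, k) * 'cV[R]_mE))%type.

Definition mk_qcqp (P0 : 'M[R]_k) (q0 : 'cV[R]_k)
    (P : 'I_mI -> 'M[R]_k) (q : 'I_mI -> 'cV[R]_k) (r : 'I_mI -> R)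
    (D : 'I_mE -> 'M[R]_k) (h : 'I_mE -> 'cV[R]_k) (g : 'I_mE -> R) : qcqp :=
  ((P0, q0),
   (\matrix_(i < mI) mxvec (P i), \matrix_(i < mI) (q i)^T, \col_i r i),
   (\matrix_(i < mE) mxvec (D i), \matrix_(i < mE) (h i)^T, \col_i g i)).

Implicit Types (t : qcqp) (z : 'cV[R]_k) (nu : 'cV[R]_mI) (la : 'cV[R]_mE).

Definition parP0 t : 'M[R]_k := t.1.1.1.
Definition parq0 t : 'cV[R]_k := t.1.1.2.
Definition parP t (i : 'I_mI) : 'M[R]_k := vec_mx (row i t.1.2.1.1).
Definition parq t (i : 'I_mI) : 'cV[R]_k := (row i t.1.2.1.2)^T.
Definition parr t (i : 'I_mI) : R := t.1.2.2 i 0.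
Definition parD t (i : 'I_mE) : 'M[R]_k := vec_mx (row i t.2.1.1).
Definition parh t (i : 'I_mE) : 'cV[R]_k := (row i t.2.1.2)^T.
Definition parg t (i : 'I_mE) : R := t.2.2 i 0.

Definition symmetric_params t : Prop :=
  [/\ (parP0 t)^T = parP0 t,
      forall i, (parP t i)^T = parP t i &
      forall i, (parD t i)^T = parD t i].

Definition objective t z : R := quad (parP0 t) (parq0 t) 0 z.
Definition ineq t (i : 'I_mI) z : R := quad (parP t i) (parq t i) (parr t i) z.
Definition equa t (i : 'I_mE) z : R := quad (parD t i) (parh t i) (parg t i) z.

Definition lagrangian t nu la z : R :=
  objective t z + \sum_i nu i 0 * ineq t i z + \sum_i la i 0 * equa t i z.

Definition feasible t z : Prop :=
  (forall i, ineq t i z <= 0) /\ (forall i, equa t i z = 0).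

Definition optimal t z : Prop :=
  feasible t z /\ forall w, feasible t w -> objective t z <= objective t w.

Definition strict_optimal_within (W : set 'cV[R]_k) t z : Prop :=
  [/\ W z, feasible t z &
      forall w, W w -> feasible t w -> w != z -> objective t z < objective t w].

Definition kkt t z nu la : Prop :=
  [/\ parP0 t *m z + parq0 t
        + \sum_i nu i 0 *: (parP t i *m z + parq t i)
        + \sum_i la i 0 *: (parD t i *m z + parh t i) = 0,
      forall i, [/\ ineq t i z <= 0, 0 <= nu i 0 & nu i 0 * ineq t i z = 0] &
      forall i, equa t i z = 0].

Definition active t z : {set 'I_mI} := [set i | ineq t i z == 0]%SET.

Definition strict_complementarity t z nu : Prop :=
  (forall i, i \in active t z -> 0 < nu i 0) /\
  (forall i, i \notin active t z -> nu i 0 = 0).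

Definition constraint_jac t z : 'M[R]_(#|active t z| + mE, k) :=
  col_mx (\matrix_(a < #|active t z|) (grad (ineq t (enum_val a)) z)^T)
         (\matrix_(i < mE) (grad (equa t i) z)^T).

Definition licq t z : Prop := row_free (constraint_jac t z).

Definition second_order_sufficient t z nu la : Prop :=
  forall u : 'cV[R]_k, constraint_jac t z *m u = 0 -> u != 0 ->
    0 < scal (u^T *m hess (lagrangian t nu la) z *m u).

Definition kkt_mx t z nu la : 'M[R]_(k + mI + mE) :=
  let M11 := parP0 t + \sum_i nu i 0 *: parP t i
                     + \sum_i la i 0 *: parD t i in
  let M12 := \matrix_(a < k, i < mI) (parP t i *m z + parq t i) a 0 in
  let M13 := \matrix_(a < k, i < mE) (parD t i *m z + parh t i) a 0 in
  let M21 := \matrix_(i < mI)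
    (nu i 0 *: (2^-1 *: (z^T *m (parP t i)^T) + 2^-1 *: (z^T *m parP t i)
                + (parq t i)^T)) in
  let M22 := diag_mx (\row_i ineq t i z) in
  let M31 := \matrix_(i < mE)
    (2^-1 *: (z^T *m (parD t i)^T) + 2^-1 *: (z^T *m parD t i)
     + (parh t i)^T) in
  block_mx (block_mx M11 M12 M21 M22) (col_mx M13 0) (row_mx M31 0) 0.

(* The dependence of (z, nu, lambda) on the parameters that the program defines
   around t.  A non-convex program only determines it locally: s is the branch
   of KKT points through (z, nu, la), the only one near (z, nu, la).  The KKT
   system is taken with the terms P_i z + q_i for arbitrary P_i, so that the
   entries of a matrix can be perturbed independently; these terms are the
   gradients of the quadratic forms exactly when the matrices are symmetric, and
   for such parameters s also yields the optimal solution of the program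
   restricted to a fixed neighbourhood W of z. *)
Definition solution_map t z nu la
    (s : qcqp -> 'cV[R]_k * 'cV[R]_mI * 'cV[R]_mE) : Prop :=
  [/\ s t = (z, nu, la),
      {for t, continuous s},
      (exists2 V, nbhs (z, nu, la) V &
        \forall t' \near t,
          [/\ V (s t'), kkt t' (s t').1.1 (s t').1.2 (s t').2 &
              forall w, V w -> kkt t' w.1.1 w.1.2 w.2 -> w = s t']) &
      (exists2 W, nbhs z W &
        \forall t' \near t,
          symmetric_params t' -> strict_optimal_within W t' (s t').1.1)].

Definition at_P0 (dP : 'M[R]_k) : qcqp :=
  mk_qcqp dP 0 (fun=> 0) (fun=> 0) (fun=> 0) (fun=> 0) (fun=> 0) (fun=> 0).
Definition at_q0 (dq : 'cV[R]_k) : qcqp :=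
  mk_qcqp 0 dq (fun=> 0) (fun=> 0) (fun=> 0) (fun=> 0) (fun=> 0) (fun=> 0).
Definition at_P (i : 'I_mI) (dP : 'M[R]_k) : qcqp :=
  mk_qcqp 0 0 (fun j => if j == i then dP else 0) (fun=> 0) (fun=> 0)
    (fun=> 0) (fun=> 0) (fun=> 0).
Definition at_q (i : 'I_mI) (dq : 'cV[R]_k) : qcqp :=
  mk_qcqp 0 0 (fun=> 0) (fun j => if j == i then dq else 0) (fun=> 0)
    (fun=> 0) (fun=> 0) (fun=> 0).
Definition at_r (i : 'I_mI) (dr : R) : qcqp :=
  mk_qcqp 0 0 (fun=> 0) (fun=> 0) (fun j => if j == i then dr else 0)
    (fun=> 0) (fun=> 0) (fun=> 0).
Definition at_D (i : 'I_mE) (dD : 'M[R]_k) : qcqp :=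
  mk_qcqp 0 0 (fun=> 0) (fun=> 0) (fun=> 0)
    (fun j => if j == i then dD else 0) (fun=> 0) (fun=> 0).
Definition at_h (i : 'I_mE) (dh : 'cV[R]_k) : qcqp :=
  mk_qcqp 0 0 (fun=> 0) (fun=> 0) (fun=> 0)
    (fun=> 0) (fun j => if j == i then dh else 0) (fun=> 0).
Definition at_g (i : 'I_mE) (dg : R) : qcqp :=
  mk_qcqp 0 0 (fun=> 0) (fun=> 0) (fun=> 0)
    (fun=> 0) (fun=> 0) (fun j => if j == i then dg else 0).

(* Gradient with respect to a matrix slot, in the layout df = \tr (G *m dP):
   G a b is the partial derivative in the entry (b, a).  On symmetric
   perturbations dP this is also the Frobenius pairing \tr (G^T *m dP). *)
Definition nabla_mx (f : qcqp -> R) (t : qcqp) (at_ : 'M[R]_k -> qcqp) :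
  'M[R]_k := \matrix_(a, b) 'D_(at_ (delta_mx b a)) f t.

Definition nabla_cv (f : qcqp -> R) (t : qcqp) (at_ : 'cV[R]_k -> qcqp) :
  'cV[R]_k := \col_a 'D_(at_ (delta_mx a 0)) f t.

Definition nabla_sc (f : qcqp -> R) (t : qcqp) (at_ : R -> qcqp) : R :=
  'D_(at_ 1) f t.

End QCQP.

(* Main.v *)
(* The KKT residual F(w, t) in the unknown w = (z, nu, lambda) is linear in the
   parameters t and polynomial in w, so that
   F(w1, t) - F(w2, t) = A(t, w1, w2) (w1 - w2) for an explicit continuous
   matrix A with A(t, w, w) = M.  This exact slope plays the role of the
   derivative in the implicit function theorem: w - M^-1 F(w, t) is a
   contraction near the KKT point, which gives the branch s, and inverting A in
   A(t', s t', s t) (s t' - s t) = - F(s t, t' - t) gives uniqueness,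
   differentiability and the derivative h |-> - M^-1 F(s t, h).  The gradients
   are then read off d^T F(w, h) with d = - M^-T (dl/dz, 0, 0).

   That the branch consists of strict local minimizers on one neighbourhood is
   a compactness argument: along z' + rho v with |v| = 1, either some constraint
   is violated to first order, or some multiplier term or the curvature of the
   Lagrangian makes the objective increase.  These are open conditions on the
   parameters, rho and v, and at rho = 0 they cover the sphere by the second
   order sufficient condition. *)

Require Import Defs.
From HB Require Import structures.
From mathcomp Require Import all_boot all_order perm all_algebra.
From mathcomp Require Import all_classical all_reals all_analysis.
From mathcomp Require Import ring lra.
Import Order.TTheory GRing.Theory Num.Theory.
Import numFieldNormedType.Exports.
Local Open Scope classical_set_scope.
Local Open Scope ring_scope.
Set Implicit Arguments.
Unset Strict Implicit.

(** * Limits of matrix-valued functions along a filter *)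

Section MatrixLimits.
Context {R : realType} {T : Type} {F : set_system T} {FF : Filter F}.

(** Neighbourhoods of a matrix are generated by entrywise ones, and finitely many eventual
    conditions hold simultaneously. Almost every limit of a matrix expression below is reduced to
    scalars in this way. *)
Lemma cvg_mx m n (A : T -> 'M[R]_(m, n)) (a : 'M[R]_(m, n)) :
  (forall i j, A x i j @[x --> F] --> a i j) -> A x @[x --> F] --> a.
Proof.
move=> Aa B [P Pa PB].
have H : \forall x \near F, forall i j, P i j (A x i j).
  by apply: filter_forall => i; apply: filter_forall => j; apply: Aa.
apply: filterS H => x Px; apply: PB => i j; exact: Px.
Qed.

Lemma cvg_entry m n (A : T -> 'M[R]_(m, n)) (a : 'M[R]_(m, n)) i j :
  A x @[x --> F] --> a -> A x i j @[x --> F] --> a i j.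
Proof. by move=> Aa; apply: (continuous_cvg _ (@coord_continuous _ _ _ i j a)). Qed.

Lemma cvg_pair_nbhs (U V : topologicalType) (f : T -> U) (g : T -> V)
    (a : U) (b : V) :
  f x @[x --> F] --> a -> g x @[x --> F] --> b ->
  (f x, g x) @[x --> F] --> (a, b).
Proof.
move=> fa gb A [[P Q] /= [Pa Qb] PQA].
have Pf : \forall x \near F, P (f x) by exact: fa.
have Qg : \forall x \near F, Q (g x) by exact: gb.
by apply: filterS2 Pf Qg => x Px Qx; apply: (PQA (f x, g x)).
Qed.

Lemma cvg_fst_nbhs (U V : topologicalType) (f : T -> U * V) (a : U * V) :
  f x @[x --> F] --> a -> (f x).1 @[x --> F] --> a.1.
Proof. by case: a => a b fa; apply: cvg_comp fa _; exact: cvg_fst. Qed.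

Lemma cvg_snd_nbhs (U V : topologicalType) (f : T -> U * V) (a : U * V) :
  f x @[x --> F] --> a -> (f x).2 @[x --> F] --> a.2.
Proof. by case: a => a b fa; apply: cvg_comp fa _; exact: cvg_snd. Qed.

Lemma cvg_sumr (I : Type) (r : seq I) (P : pred I) (V : normedModType R)
    (f : I -> T -> V) (a : I -> V) :
  (forall i, f i x @[x --> F] --> a i) ->
  \sum_(i <- r | P i) f i x @[x --> F] --> \sum_(i <- r | P i) a i.
Proof.
move=> fa; elim: r => [|i r IH].
  under eq_fun do rewrite big_nil.
  by rewrite big_nil; apply: cvg_cst.
under eq_fun do rewrite big_cons.
by rewrite big_cons; case: (P i) => //; apply: cvgD.
Qed.

Lemma cvg_prodr (I : Type) (r : seq I) (P : pred I) (f : I -> T -> R) (a : I -> R) :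
  (forall i, f i x @[x --> F] --> a i) ->
  \prod_(i <- r | P i) f i x @[x --> F] --> \prod_(i <- r | P i) a i.
Proof.
move=> fa; elim: r => [|i r IH].
  under eq_fun do rewrite big_nil.
  by rewrite big_nil; apply: cvg_cst.
under eq_fun do rewrite big_cons.
by rewrite big_cons; case: (P i) => //; apply: cvgM.
Qed.

Lemma cvg_mulmx m n p (A : T -> 'M[R]_(m, n)) (B : T -> 'M[R]_(n, p))
    (a : 'M[R]_(m, n)) (b : 'M[R]_(n, p)) :
  A x @[x --> F] --> a -> B x @[x --> F] --> b ->
  A x *m B x @[x --> F] --> a *m b.
Proof.
move=> Aa Bb; apply: cvg_mx => i j; under eq_fun do rewrite mxE.
by rewrite mxE; apply: cvg_sumr => l; apply: cvgM; apply: cvg_entry.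
Qed.

Lemma cvg_trmx m n (A : T -> 'M[R]_(m, n)) (a : 'M[R]_(m, n)) :
  A x @[x --> F] --> a -> (A x)^T @[x --> F] --> a^T.
Proof.
move=> Aa; apply: cvg_mx => i j; under eq_fun do rewrite mxE.
by rewrite mxE; apply: cvg_entry.
Qed.

Lemma cvg_row_mx m n p (A : T -> 'M[R]_(m, n)) (B : T -> 'M[R]_(m, p))
    (a : 'M[R]_(m, n)) (b : 'M[R]_(m, p)) :
  A x @[x --> F] --> a -> B x @[x --> F] --> b ->
  row_mx (A x) (B x) @[x --> F] --> row_mx a b.
Proof.
move=> Aa Bb; apply: cvg_mx => i j; under eq_fun do rewrite mxE.
by rewrite mxE; case: (fintype.split j) => l; apply: cvg_entry.
Qed.

Lemma cvg_col_mx m n p (A : T -> 'M[R]_(m, n)) (B : T -> 'M[R]_(p, n))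
    (a : 'M[R]_(m, n)) (b : 'M[R]_(p, n)) :
  A x @[x --> F] --> a -> B x @[x --> F] --> b ->
  col_mx (A x) (B x) @[x --> F] --> col_mx a b.
Proof.
move=> Aa Bb; apply: cvg_mx => i j; under eq_fun do rewrite mxE.
by rewrite mxE; case: (fintype.split i) => l; apply: cvg_entry.
Qed.

Lemma cvg_block_mx m1 m2 n1 n2 (A : T -> 'M[R]_(m1, n1)) (B : T -> 'M[R]_(m1, n2))
    (C : T -> 'M[R]_(m2, n1)) (D : T -> 'M[R]_(m2, n2))
    (a : 'M[R]_(m1, n1)) (b : 'M[R]_(m1, n2))
    (c : 'M[R]_(m2, n1)) (d : 'M[R]_(m2, n2)) :
  A x @[x --> F] --> a -> B x @[x --> F] --> b ->
  C x @[x --> F] --> c -> D x @[x --> F] --> d ->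
  block_mx (A x) (B x) (C x) (D x) @[x --> F] --> block_mx a b c d.
Proof. by move=> *; apply: cvg_col_mx; apply: cvg_row_mx. Qed.

Lemma cvg_usubmx m n p (A : T -> 'M[R]_(m + p, n)) (a : 'M[R]_(m + p, n)) :
  A x @[x --> F] --> a -> usubmx (A x) @[x --> F] --> usubmx a.
Proof.
move=> Aa; apply: cvg_mx => i j; under eq_fun do rewrite mxE.
by rewrite mxE; apply: cvg_entry.
Qed.

Lemma cvg_dsubmx m n p (A : T -> 'M[R]_(m + p, n)) (a : 'M[R]_(m + p, n)) :
  A x @[x --> F] --> a -> dsubmx (A x) @[x --> F] --> dsubmx a.
Proof.
move=> Aa; apply: cvg_mx => i j; under eq_fun do rewrite mxE.
by rewrite mxE; apply: cvg_entry.
Qed.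

(** Leibniz's expansion is a finite sum of products of entries. *)
Lemma cvg_det n (A : T -> 'M[R]_n) (a : 'M[R]_n) :
  A x @[x --> F] --> a -> \det (A x) @[x --> F] --> \det a.
Proof.
move=> Aa; apply: cvg_sumr => s; apply: cvgM; first exact: cvg_cst.
by apply: (@cvg_prodr _ _ _ (fun i x => A x i (s i)) (fun i => a i (s i)))
  => i /=; apply: cvg_entry.
Qed.

Lemma near_unitmx n (A : T -> 'M[R]_n) (a : 'M[R]_n) :
  A x @[x --> F] --> a -> a \in unitmx -> \forall x \near F, A x \in unitmx.
Proof.
move=> Aa; rewrite unitmxE unitfE => a0.
apply: filterS (cvgr_neq0 _ (cvg_det Aa) a0) => x.
by rewrite unitmxE unitfE.
Qed.

Lemma cvg_invmx n (A : T -> 'M[R]_n) (a : 'M[R]_n) :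
  A x @[x --> F] --> a -> a \in unitmx ->
  invmx (A x) @[x --> F] --> invmx a.
Proof.
move=> Aa a_unit.
have : (\det (A x))^-1 *: \adj (A x) @[x --> F] --> (\det a)^-1 *: \adj a.
  apply: cvgZ.
    apply: cvgV; last exact: cvg_det.
    by move: a_unit; rewrite unitmxE unitfE.
  apply: cvg_mx => i j; under eq_fun do rewrite mxE.
  rewrite mxE; apply: cvgM; first exact: cvg_cst.
  apply: cvg_det; apply: cvg_mx => i' j'; under eq_fun do rewrite !mxE.
  by rewrite !mxE; apply: cvg_entry.
(* [invmx] equals the adjugate formula only on invertible matrices and is the identity function
   elsewhere, so the two functions are compared on the neighbourhood where [A x] is invertible. *)
rewrite {2}/invmx a_unit; apply: cvg_trans; apply: near_eq_cvg.
apply: filterS (near_unitmx Aa a_unit) => x Ax.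
by rewrite /invmx Ax.
Qed.

End MatrixLimits.

(** * Norm estimates and differentiability from an exact slope *)

Lemma mxentry_norm_le {R : realType} m n (A : 'M[R]_(m, n)) i j :
  `|A i j| <= `|A|.
Proof.
rewrite [leRHS]/Num.Def.normr/= mx_normrE.
exact: (le_bigmax _ (fun ij : 'I_m * 'I_n => `|A ij.1 ij.2|) (i, j)).
Qed.

(** The norm is the largest absolute value of an entry, which is not submultiplicative: each entry
    of the product is a sum of [n] terms, whence the factor. *)
Lemma mulmx_norm_le {R : realType} m n p (A : 'M[R]_(m, n)) (B : 'M[R]_(n, p)) :
  `|A *m B| <= n%:R * `|A| * `|B|.
Proof.
rewrite [leLHS]/Num.Def.normr/= mx_normrE; apply: bigmax_le => [|[i j] _] /=.
  by rewrite !mulr_ge0.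
rewrite mxE (le_trans (ler_norm_sum _ _ _))//.
have -> : n%:R * `|A| * `|B| = \sum_(l < n) `|A| * `|B|.
  by rewrite sumr_const card_ord -mulrA mulr_natl.
by apply: ler_sum => l _; rewrite normrM ler_pM// mxentry_norm_le.
Qed.

(** Carathéodory's form of differentiability: the error of the linear approximation is
    [(C y - C x) *m L (y - x)], which is small relative to [y - x] because [C] is continuous at [x]
    and [L] is Lipschitz. *)
Lemma is_diff_slope {R : realType} (X : normedModType R) n (f : X -> 'cV[R]_n)
    (C : X -> 'M[R]_n) (L : {linear X -> 'cV[R]_n}) (x : X) :
  continuous L -> C y @[y --> x] --> C x ->
  (\forall y \near x, f y - f x = C y *m L (y - x)) ->
  is_diff x f (fun h => C x *m L h).
Proof.
move=> Lcont Ccont fE.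
pose df : {linear X -> 'cV[R]_n} := mulmx (C x) \o L.
have dfcont : continuous df.
  by move=> y; apply: cvg_mulmx; [exact: cvg_cst|exact: Lcont].
have fo : f \o shift x = cst (f x) + df +o_ 0 id.
  apply/eqaddoP => e e0.
  have [K K0 LK] := linear_lipschitz Lcont.
  (* Adding 1 keeps the denominator positive even when [n] is 0. *)
  have nK0 : 0 < n%:R * K + 1 :> R by rewrite ltr_wpDl// mulr_ge0// ltW.
  have Ce : \forall y \near x, `|C y - C x| < e / (n%:R * K + 1).
    by apply: cvgr_distC_lt Ccont _ _; rewrite divr_gt0.
  have : \forall y \near x,
    `|f y - f x - C x *m L (y - x)| <= e * `|y - x|.
    near=> y.
    have -> : f y - f x - C x *m L (y - x) = (C y - C x) *m L (y - x).
      by rewrite mulmxBl; congr (_ - _); near: y.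
    rewrite (le_trans (mulmx_norm_le _ _))//.
    have cy : `|C y - C x| <= e / (n%:R * K + 1) by apply: ltW; near: y.
    rewrite (@le_trans _ _ (n%:R * (e / (n%:R * K + 1)) * (K * `|y - x|)))//.
      by rewrite ler_pM// ?mulr_ge0// ler_wpM2l.
    rewrite !mulrA ler_wpM2r//.
    rewrite mulrAC ler_pdivrMr// [n%:R * e]mulrC -mulrA mulrDr mulr1 lerDl.
    exact: ltW.
  rewrite (near_shift 0) /=; apply: filterS => h /=.
  by rewrite subr0 addrK opprD addrA.
have dE : 'd f x = df :> (X -> 'cV[R]_n) by apply: diff_unique.
split; last by rewrite dE.
by apply/diff_locallyP; rewrite dE.
Unshelve. all: by end_near. Qed.

(** * An implicit function theorem for equations with an exact slope *)

Section ImplicitFunction.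
Context {R : realType} {X : normedModType R} {n : nat}.
Variables (F : 'cV[R]_n -> {linear X -> 'cV[R]_n}).
Variables (A : X -> 'cV[R]_n -> 'cV[R]_n -> 'M[R]_n).
Hypothesis F_cont : forall w, continuous (F w).
Hypothesis F_slope : forall x w1 w2,
  F w1 x - F w2 x = A x w1 w2 *m (w1 - w2).
Hypothesis A_cont : forall p : X * 'cV[R]_n * 'cV[R]_n,
  A q.1.1 q.1.2 q.2 @[q --> p] --> A p.1.1 p.1.2 p.2.
Variables (x0 : X) (w0 : 'cV[R]_n).
Hypothesis F0 : F w0 x0 = 0.
Hypothesis A0 : A x0 w0 w0 \in unitmx.

Let M := A x0 w0 w0.

Lemma near_triple (P : X -> 'cV[R]_n -> 'cV[R]_n -> Prop) :
  (\forall p \near (x0, w0, w0), P p.1.1 p.1.2 p.2) ->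
  exists2 r, 0 < r & \forall x \near x0, forall w1 w2,
    `|w0 - w1| <= r -> `|w0 - w2| <= r -> P x w1 w2.
Proof.
(* Balls are open while the conclusion uses large inequalities, hence half the radius. *)
move=> /nbhs_ballP[e /= e0 eP]; exists (e / 2); first by rewrite divr_gt0.
near=> x => w1 w2 w1r w2r.
have lt2 : e / 2 < e by rewrite ltr_pdivrMr// mulr2n mulrDr mulr1 ltrDl.
apply: (eP (x, w1, w2)); split; first split => /=.
- by near: x; apply: nbhsx_ballx.
- by rewrite -ball_normE /= (le_lt_trans w1r).
- by rewrite -ball_normE /= (le_lt_trans w2r).
Unshelve. all: by end_near. Qed.

(** By [F_slope] the left-hand vector is [(1 - M^-1 A) (w1 - w2)], and [A] is close to [M] near the
    base point. This single estimate yields existence, uniqueness and continuity of the branch. *)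
Lemma newton_contraction : exists2 r, 0 < r & \forall x \near x0,
  forall w1 w2, `|w0 - w1| <= r -> `|w0 - w2| <= r ->
    `|(w1 - w2) - invmx M *m (F w1 x - F w2 x)| <= 2^-1 * `|w1 - w2|.
Proof.
(* The factor [n%:R] absorbs the dimension constant of [mulmx_norm_le]. *)
suff /(@near_triple (fun x w1 w2 =>
    `|n%:R *: (1%:M - invmx M *m A x w1 w2)| < 2^-1))[r r0 H] :
    \forall p \near (x0, w0, w0),
      `|n%:R *: (1%:M - invmx M *m A p.1.1 p.1.2 p.2)| < 2^-1.
  exists r => //; apply: filterS H => x H w1 w2 w1r w2r.
  rewrite F_slope mulmxA -{1}[w1 - w2]mul1mx -mulmxBl.
  rewrite (le_trans (mulmx_norm_le _ _))// ler_wpM2r//.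
  have := H _ _ w1r w2r; rewrite normrZ ger0_norm//; exact: ltW.
have : n%:R *: (1%:M - invmx M *m A p.1.1 p.1.2 p.2)
    @[p --> (x0, w0, w0)] --> (n%:R : R) *: (1%:M - invmx M *m M).
  apply: cvgZ; first exact: cvg_cst.
  apply: cvgB; first exact: cvg_cst.
  by apply: cvg_mulmx; [exact: cvg_cst|exact: (@A_cont (x0, w0, w0))].
rewrite mulVmx// subrr scaler0 => /cvgr_norm_lt; apply.
by rewrite normr0 invr_gt0.
Qed.

Lemma implicit_function_unique : exists2 r, 0 < r & \forall x \near x0,
  forall w1 w2, `|w0 - w1| <= r -> `|w0 - w2| <= r ->
    F w1 x = 0 -> F w2 x = 0 -> w1 = w2.
Proof.
have [r r0 H] := newton_contraction; exists r => //.
apply: filterS H => x H w1 w2 w1r w2r F1 F2.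
have := H _ _ w1r w2r; rewrite F1 F2 subrr mulmx0 subr0 => le2.
have : `|w1 - w2| <= 0 by lra.
by rewrite normr_le0 subr_eq0 => /eqP.
Qed.

(** For each [x] near [x0], Banach's theorem is applied to the simplified Newton map
    [w - M^-1 F w x] on a closed ball around [w0]. *)
Lemma implicit_function_exists : exists s : X -> 'cV[R]_n,
  [/\ s x0 = w0, {for x0, continuous s} & \forall x \near x0, F (s x) x = 0].
Proof.
have [r r0 H] := newton_contraction.
have Fw0 : invmx M *m F w0 x @[x --> x0] --> (0 : 'cV[R]_n).
  rewrite -(mulmx0 _ (invmx M)) -F0.
  by apply: cvg_mulmx; [exact: cvg_cst|exact: F_cont].
(* The bound on the distance to [w0] is kept with the zero: it vanishes at [x0] and tends to 0
   there, which gives both [s x0 = w0] and continuity. *)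
have sol : \forall x \near x0, exists2 w,
    F w x = 0 & `|w0 - w| <= 2 * `|invmx M *m F w0 x|.
  near=> x.
  have Hx : forall w1 w2, `|w0 - w1| <= r -> `|w0 - w2| <= r ->
    `|(w1 - w2) - invmx M *m (F w1 x - F w2 x)| <= 2^-1 * `|w1 - w2|.
    by near: x.
  (* Half the radius for the displacement of [w0] and half for the contraction: [G] maps the ball
     into itself. *)
  have Fr : `|invmx M *m F w0 x| < r / 2.
    near: x; apply: (cvgr_norm_lt _ Fw0); by rewrite normr0 divr_gt0.
  pose G w := w - invmx M *m F w x.
  have GB w1 w2 : `|w0 - w1| <= r -> `|w0 - w2| <= r ->
      `|G w1 - G w2| <= 2^-1 * `|w1 - w2|.
    move=> w1r w2r; apply: le_trans (Hx _ _ w1r w2r).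
    rewrite (_ : G w1 - G w2 = w1 - w2 - invmx M *m (F w1 x - F w2 x))//.
    by rewrite mulmxBr /G !opprB addrACA [RHS]addrACA [- w2 + _]addrC.
  have Gw0 w : `|w0 - w| <= r ->
      `|w0 - G w| <= `|invmx M *m F w0 x| + 2^-1 * `|w0 - w|.
    move=> wr; have -> : w0 - G w = invmx M *m F w0 x + (G w0 - G w).
      by rewrite /G addrA [in RHS]addrCA subrr addr0.
    rewrite (le_trans (ler_normD _ _))// lerD2l GB//.
    by rewrite subrr normr0 ltW.
  pose U := [set w : 'cV[R]_n | `|w0 - w| <= r].
  have GU : set_fun U U G.
    move=> w /= wr; apply: (le_trans (Gw0 _ wr)).
    by move: (wr) (ltW Fr); rewrite /U /=; lra.
  have Ucl : closed U by exact: closed_closed_ball_.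
  pose Gf : {fun U >-> U} := HB.pack G (isFun.Build _ _ _ _ _ GU).
  pose V : completeNormedModType R := HB.pack 'cV[R]_n.
  have [||] := @banach_fixed_point R V U Gf _ Ucl.
  - exists (2^-1)%:nng; split => /=; first by lra.
    by move=> [w1 w2] /= [] w1r w2r; apply: GB.
  - by exists w0; rewrite /U /= subrr normr0 ltW.
  move=> w wr /= wG; exists w.
    have : invmx M *m F w x = 0.
      by apply/eqP; rewrite -oppr_eq0 -(inj_eq (addrI w)) addr0; apply/eqP.
    by move=> /(congr1 (mulmx M)); rewrite mulmxA mulmxV// mul1mx mulmx0.
  have := Gw0 _ wr; rewrite -[G w]wG; lra.
(* Choice requires a value at every [x]; where no suitable zero exists the value is arbitrary. *)
have /choice[s sE] : forall x, exists w',
    (exists2 w, F w x = 0 & `|w0 - w| <= 2 * `|invmx M *m F w0 x|) ->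
    F w' x = 0 /\ `|w0 - w'| <= 2 * `|invmx M *m F w0 x|.
  move=> x; have [[w Fw wx]|no] := pselect (exists2 w,
    F w x = 0 & `|w0 - w| <= 2 * `|invmx M *m F w0 x|).
    by exists w.
  by exists w0.
have sx0 : s x0 = w0.
  have [_] := sE _ (nbhs_singleton sol).
  by rewrite F0 mulmx0 normr0 mulr0 normr_le0 subr_eq0 => /eqP.
exists s; split => //.
- rewrite /prop_for /continuous_at sx0; apply/cvgrPdist_lt => e e0.
  near=> x.
  have [_ /le_lt_trans] : F (s x) x = 0 /\ `|w0 - s x| <= 2 * `|invmx M *m F w0 x|.
    by apply: sE; near: x.
  apply.
  rewrite mulrC -ltr_pdivlMr//; near: x.
  by apply: (cvgr_norm_lt _ Fw0); rewrite normr0 divr_gt0.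
- by apply: filterS sol => x /sE[].
Unshelve. all: by end_near. Qed.

(** The conclusion holds throughout a neighbourhood although continuity is assumed at [x0] only: the
    contraction estimate, valid around every nearby [x], propagates continuity there. *)
Lemma implicit_function_diff (s : X -> 'cV[R]_n) :
  s x0 = w0 -> {for x0, continuous s} -> (\forall x \near x0, F (s x) x = 0) ->
  \forall x \near x0,
    is_diff x s (fun h => - invmx (A x (s x) (s x)) *m F (s x) h).
Proof.
move=> sx0 s_cont s_sol.
have [r r0 contr] := newton_contraction.
have [r' r'0 unitA] : exists2 r, 0 < r & \forall x \near x0, forall w1 w2,
    `|w0 - w1| <= r -> `|w0 - w2| <= r -> A x w1 w2 \in unitmx.
  apply: (@near_triple (fun x w1 w2 => A x w1 w2 \in unitmx)).
  exact: (near_unitmx (@A_cont (x0, w0, w0))).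
have s_near e : 0 < e -> \forall x \near x0, `|w0 - s x| <= e.
  move=> e0; move: s_cont; rewrite /prop_for /continuous_at sx0.
  by move=> /cvgrPdist_le; exact.
pose ok x := [/\ F (s x) x = 0, `|w0 - s x| <= r, `|w0 - s x| <= r',
  forall w1 w2, `|w0 - w1| <= r -> `|w0 - w2| <= r ->
    `|(w1 - w2) - invmx M *m (F w1 x - F w2 x)| <= 2^-1 * `|w1 - w2| &
  forall w1 w2, `|w0 - w1| <= r' -> `|w0 - w2| <= r' -> A x w1 w2 \in unitmx].
have okx0 : nbhs x0 [set x | ok x].
  near=> x; split; near: x => //; exact: s_near.
near=> x.
(* Passing to the interior makes [ok] hold at [x] and also on a neighbourhood of [x]. *)
have okx : ok x by apply: nbhs_singleton; near: x; exact: nbhs_interior okx0.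
have near_ok : \forall y \near x, ok y by near: x; exact: nbhs_interior okx0.
have [Fx sxr sxr' _ _] := okx.
(* Since [F (s y) y = 0], the contraction bounds [s y - s x] by twice [M^-1 F (s x) y], which tends
   to [M^-1 F (s x) x = 0]. *)
have s_contx : s y @[y --> x] --> s x.
  have F_cvg : invmx M *m F (s x) y @[y --> x] --> (0 : 'cV[R]_n).
    rewrite -(mulmx0 _ (invmx M)) -Fx.
    by apply: cvg_mulmx; [exact: cvg_cst|exact: F_cont].
  apply/cvgrPdist_lt => e e0; near=> y.
  have [Fy syr _ contry _] : ok y by near: y.
  have := contry _ _ syr sxr; rewrite Fy sub0r mulmxN opprK => le2.
  have lte : `|invmx M *m F (s x) y| < e / 2.
    by near: y; apply: (cvgr_norm_lt _ F_cvg); rewrite normr0 divr_gt0.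
  have := ler_normB (s y - s x + invmx M *m F (s x) y) (invmx M *m F (s x) y).
  by rewrite addrK [`|s x - s y|]distrC; lra.
apply: (is_diff_slope (C := fun y => - invmx (A y (s y) (s x)))).
- exact: F_cont.
- apply: cvgN; apply: cvg_invmx.
    apply: (@cvg_comp _ _ _ (fun y => (y, s y, s x))
      (fun q => A q.1.1 q.1.2 q.2) _ (nbhs (x, s x, s x))); last exact: A_cont.
    apply: cvg_pair_nbhs; last exact: cvg_cst.
    by apply: cvg_pair_nbhs => //; exact: cvg_id.
  by have [_ _ _ _] := okx; apply.
(* Both residuals vanish on the branch, so [- F (s x) (y - x)] equals [F (s y) y - F (s x) y], that
   is, [A y (s y) (s x)] applied to [s y - s x]; inverting [A] gives the slope of [s]. *)
- apply: filterS near_ok => y [Fy _ syr' _ unity].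
  have Aunit := unity _ _ syr' sxr'.
  rewrite linearB /= Fx subr0 mulNmx -mulmxN -[- F _ _]add0r -Fy F_slope.
  by rewrite mulmxA mulVmx// mul1mx.
Unshelve. all: by end_near. Qed.

End ImplicitFunction.

(** * Exact expansions and derivatives of quadratic functions *)

Section Quadratics.
Context {R : realType} {k : nat}.
Implicit Types (P : 'M[R]_k) (q z u v : 'cV[R]_k) (r : R).

Lemma scalD (a b : 'M[R]_1) : scal (a + b) = scal a + scal b.
Proof. by rewrite /scal mxE. Qed.

Lemma scalN (a : 'M[R]_1) : scal (- a) = - scal a.
Proof. by rewrite /scal mxE. Qed.

Lemma scalZ c (a : 'M[R]_1) : scal (c *: a) = c * scal a.
Proof. by rewrite /scal mxE. Qed.

Lemma scal_sum I (s : seq I) (A : pred I) (f : I -> 'M[R]_1) :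
  scal (\sum_(i <- s | A i) f i) = \sum_(i <- s | A i) scal (f i).
Proof. by rewrite /scal summxE. Qed.

Lemma scal_tr (a : 'M[R]_1) : scal a^T = scal a.
Proof. by rewrite /scal mxE. Qed.

(** An exact difference quotient of a quadratic, for [P] not necessarily symmetric. At [z1 = z2] it
    is the row that occurs in the blocks M21 and M31 of the KKT matrix. *)
Definition quad_slope P q z1 z2 : 'rV[R]_k :=
  2^-1 *: (z2^T *m P^T) + 2^-1 *: (z1^T *m P) + q^T.

(** The mixed terms [z2^T P^T z1] and [z1^T P z2] are transposes of each other as scalars, so they
    cancel. *)
Lemma quad_slopeE P q r z1 z2 :
  quad P q r z1 - quad P q r z2 = scal (quad_slope P q z1 z2 *m (z1 - z2)).
Proof.
have tr : scal (z2^T *m P^T *m z1) = scal (z1^T *m P *m z2).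
  by rewrite -[LHS]scal_tr !trmx_mul !trmxK mulmxA.
have tr2 : scal (z2^T *m P^T *m z2) = scal (z2^T *m P *m z2).
  by rewrite -[LHS]scal_tr !trmx_mul !trmxK mulmxA.
rewrite /quad /quad_slope !mulmxDl !mulmxBr -!scalemxAl.
by rewrite !(scalD, scalN, scalZ) tr tr2; ring.
Qed.

Lemma quad_slope_diag P q z :
  quad_slope P q z z = (2^-1 *: ((P + P^T) *m z) + q)^T.
Proof.
rewrite /quad_slope linearD /= linearZ /= trmx_mul linearD /= trmxK.
by rewrite mulmxDr scalerDr.
Qed.

Lemma quad_slope_sym P q z : P^T = P -> quad_slope P q z z = (P *m z + q)^T.
Proof.
move=> Ps; rewrite quad_slope_diag Ps -mulr2n -[P *+ 2]scaler_nat -scalemxAl.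
by rewrite scalerA mulVf ?pnatr_eq0// scale1r.
Qed.

Lemma quadD P q r z u : quad P q r (z + u) =
  quad P q r z + scal (quad_slope P q z z *m u) + 2^-1 * scal (u^T *m P *m u).
Proof.
have /eqP := quad_slopeE P q r (z + u) z; rewrite subr_eq => /eqP ->.
rewrite [z + u]addrC addrK /quad_slope linearD /= !mulmxDl -!scalemxAl.
by rewrite !mulmxDl !(scalD, scalZ); ring.
Qed.

(** The difference quotient is [c1 + h * c2], so first derivatives of quadratics and of their
    (affine) partial derivatives are read off algebraically. *)
Lemma derive_polynomial2 (f : 'cV[R]_k -> R) z v c1 c2 :
  (forall h, f (h *: v + z) = f z + h * c1 + h ^+ 2 * c2) -> 'D_v f z = c1.
Proof.
move=> fE; apply: cvg_lim => //.
have : c1 + h * c2 @[h --> 0^'] --> c1 + 0 * c2.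
  apply: cvgD; first exact: cvg_cst.
  apply: cvgM; last exact: cvg_cst.
  exact: nbhs_dnbhs.
rewrite mul0r addr0; apply: cvg_trans; apply: near_eq_cvg.
near=> h.
have h0 : h != 0 by near: h; exact: nbhs_dnbhs_neq.
rewrite /= fE -[RHS]/(h^-1 * (f z + h * c1 + h ^+ 2 * c2 - f z)).
by field.
Unshelve. all: by end_near. Qed.

Lemma derive_quad P q r z v :
  'D_v (quad P q r) z = scal (quad_slope P q z z *m v).
Proof.
apply: (@derive_polynomial2 _ _ _ _ (2^-1 * scal (v^T *m P *m v))) => h.
rewrite addrC quadD -scalemxAr scalZ; congr (_ + _).
by rewrite [(h *: v)^T]linearZ /= -!scalemxAl -scalemxAr !scalZ; ring.
Qed.

Lemma grad_quad P q r z : grad (quad P q r) z = (quad_slope P q z z)^T.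
Proof.
apply/colP => i; rewrite !mxE derive_quad /scal -colE.
by rewrite !mxE.
Qed.

Lemma hess_quad P q r z : hess (quad P q r) z = 2^-1 *: (P + P^T).
Proof.
have dE i w : 'D_(delta_mx i 0) (quad P q r) w =
    scal (delta_mx 0 i *m (2^-1 *: ((P + P^T) *m w) + q)).
  by rewrite derive_quad quad_slope_diag -[RHS]scal_tr trmx_mul trmx_delta.
apply/matrixP => i j; rewrite mxE.
apply: (@derive_polynomial2 _ _ _ _ 0) => h.
rewrite !dE mulr0 addr0 [(P + P^T) *m (_ + z)]mulmxDr scalerDr -addrA.
rewrite [delta_mx 0 i *m (_ + (_ + _))]mulmxDr scalD addrC; congr (_ + _).
rewrite -!scalemxAr !scalZ mulrCA; congr (h * _).
by rewrite -colE -rowE /scal !mxE.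
Qed.

Section Continuity.
Context {T : Type} {F : set_system T} {FF : Filter F}.
Variables (Ps : T -> 'M[R]_k) (P : 'M[R]_k) (qs : T -> 'cV[R]_k) (q : 'cV[R]_k).
Hypotheses (PsP : Ps x @[x --> F] --> P) (qsq : qs x @[x --> F] --> q).

Lemma cvg_quad (rs : T -> R) (r : R) (zs : T -> 'cV[R]_k) (z : 'cV[R]_k) :
  rs x @[x --> F] --> r -> zs x @[x --> F] --> z ->
  quad (Ps x) (qs x) (rs x) (zs x) @[x --> F] --> quad P q r z.
Proof.
move=> rsr zsz; apply: cvgD => //; apply: cvgD.
  apply: cvgM; first exact: cvg_cst.
  apply: cvg_entry; apply: cvg_mulmx => //; apply: cvg_mulmx => //.
  exact: cvg_trmx.
by apply: cvg_entry; apply: cvg_mulmx => //; exact: cvg_trmx.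
Qed.

Lemma cvg_quad_slope (zs1 zs2 : T -> 'cV[R]_k) (z1 z2 : 'cV[R]_k) :
  zs1 x @[x --> F] --> z1 -> zs2 x @[x --> F] --> z2 ->
  quad_slope (Ps x) (qs x) (zs1 x) (zs2 x) @[x --> F] --> quad_slope P q z1 z2.
Proof.
move=> z1P z2P; apply: cvgD; last exact: cvg_trmx.
apply: cvgD; (apply: cvgZ; first exact: cvg_cst); apply: cvg_mulmx => //;
  exact: cvg_trmx.
Qed.

End Continuity.

End Quadratics.

(** * The KKT residual, its exact slope, and its dependence on the parameters *)

Section KktSystem.
Context {R : realType} {k mI mE : nat}.
Notation qcqp := (qcqp R k mI mE).
Implicit Types (t : qcqp) (z u : 'cV[R]_k) (nu : 'cV[R]_mI) (la : 'cV[R]_mE).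
Implicit Types (w : 'cV[R]_(k + mI + mE)).

(* The secant form of [kkt_mx]: it maps a difference of two arguments of
   [kkt_res] to the difference of the values. *)
Definition kkt_slope t z1 nu la z2 : 'M[R]_(k + mI + mE) :=
  block_mx
    (block_mx
      (parP0 t + \sum_i nu i 0 *: parP t i + \sum_i la i 0 *: parD t i)
      (\matrix_(a < k, i < mI) (parP t i *m z2 + parq t i) a 0)
      (\matrix_(i < mI) (nu i 0 *: quad_slope (parP t i) (parq t i) z1 z2))
      (diag_mx (\row_i ineq t i z2)))
    (col_mx (\matrix_(a < k, i < mE) (parD t i *m z2 + parh t i) a 0) 0)
    (row_mx (\matrix_(i < mE) quad_slope (parD t i) (parh t i) z1 z2) 0)
    0.

Lemma kkt_slope_diag t z nu la : kkt_slope t z nu la z = kkt_mx t z nu la.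
Proof. by []. Qed.

Lemma mulmx_cols (n m : nat) (f : 'I_m -> 'cV[R]_n) (a : 'cV[R]_m) :
  (\matrix_(j < n, i < m) f i j 0) *m a = \sum_i a i 0 *: f i.
Proof.
apply/colP => j; rewrite mxE summxE; apply: eq_bigr => i _.
by rewrite !mxE mulrC.
Qed.

Lemma mulmx_rows (n m : nat) (f : 'I_m -> 'rV[R]_n) (u : 'cV[R]_n) :
  (\matrix_(i < m) f i) *m u = \col_i scal (f i *m u).
Proof.
apply/colP => j; rewrite mxE [RHS]mxE /scal mxE; apply: eq_bigr => i _.
by rewrite mxE.
Qed.

Lemma mul_kkt_slope t z1 nu la z2 u (a : 'cV[R]_mI) (b : 'cV[R]_mE) :
  kkt_slope t z1 nu la z2 *m col_mx (col_mx u a) b =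
  col_mx (col_mx
    ((parP0 t + \sum_i nu i 0 *: parP t i + \sum_i la i 0 *: parD t i) *m u
      + \sum_i a i 0 *: (parP t i *m z2 + parq t i)
      + \sum_i b i 0 *: (parD t i *m z2 + parh t i))
    (\col_i (nu i 0 * scal (quad_slope (parP t i) (parq t i) z1 z2 *m u)
      + ineq t i z2 * a i 0)))
    (\col_i scal (quad_slope (parD t i) (parh t i) z1 z2 *m u)).
Proof.
rewrite /kkt_slope mul_block_col mul_block_col mul_col_mx mul0mx mul0mx addr0.
rewrite mul_row_col mul0mx addr0 add_col_mx addr0 !mulmx_cols !mulmx_rows.
congr (col_mx (col_mx _ _) _).
apply/colP => i; rewrite mul_diag_mx [LHS]mxE !(mxE _ _ i 0) -scalemxAl scalZ.
by rewrite mxE.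
Qed.

(** Only the equalities of the KKT conditions are recorded; [kkt_of_res] recovers the sign
    conditions. The unknown comes first because the map is linear in [t] for fixed [w]. *)
Definition kkt_res w t : 'cV[R]_(k + mI + mE) :=
  let z := usubmx (usubmx w) in
  let nu := dsubmx (usubmx w) in
  let la := dsubmx w in
  col_mx (col_mx
    (parP0 t *m z + parq0 t
        + \sum_i nu i 0 *: (parP t i *m z + parq t i)
        + \sum_i la i 0 *: (parD t i *m z + parh t i))
    (\col_i (nu i 0 * ineq t i z)))
    (\col_i equa t i z).

(** A discrete product rule: the multipliers that weight [z1 - z2] are those of the first point, and
    the vectors that weight [n1 - n2] are taken at the second. *)
Lemma sum_slope m (Q : 'I_m -> 'M[R]_k) (c : 'I_m -> 'cV[R]_k)
    (n1 n2 : 'cV[R]_m) (z1 z2 : 'cV[R]_k) :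
  \sum_i n1 i 0 *: (Q i *m z1 + c i) - \sum_i n2 i 0 *: (Q i *m z2 + c i) =
  (\sum_i n1 i 0 *: Q i) *m (z1 - z2)
    + \sum_i (n1 - n2) i 0 *: (Q i *m z2 + c i).
Proof.
rewrite -sumrB mulmx_suml -big_split /=; apply: eq_bigr => i _.
rewrite !mxE -scalemxAl mulmxBr scalerBl addrA.
by rewrite -scalerDr [in RHS]addrA subrK.
Qed.

(** The product rule of [sum_slope] handles stationarity; likewise [nu1 p(z1) - nu2 p(z2) = nu1
    (p(z1) - p(z2)) + (nu1 - nu2) p(z2)] handles complementarity. This is why [kkt_slope] mixes data
    of both points. *)
Lemma kkt_res_slope t w1 w2 : kkt_res w1 t - kkt_res w2 t =
  kkt_slope t (usubmx (usubmx w1)) (dsubmx (usubmx w1)) (dsubmx w1)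
    (usubmx (usubmx w2)) *m (w1 - w2).
Proof.
rewrite -[w1 - w2]vsubmxK -[usubmx (_ - _)]vsubmxK mul_kkt_slope /kkt_res.
rewrite !opp_col_mx !add_col_mx.
have -> : usubmx (usubmx (w1 - w2)) =
  usubmx (usubmx w1) - usubmx (usubmx w2) by rewrite !linearB.
have -> : dsubmx (usubmx (w1 - w2)) =
  dsubmx (usubmx w1) - dsubmx (usubmx w2) by rewrite !linearB.
have -> : dsubmx (w1 - w2) = dsubmx w1 - dsubmx w2 by rewrite linearB.
set z1 := usubmx (usubmx w1); set z2 := usubmx (usubmx w2).
set nu1 := dsubmx (usubmx w1); set nu2 := dsubmx (usubmx w2).
set la1 := dsubmx w1; set la2 := dsubmx w2.
congr (col_mx (col_mx _ _) _).
- rewrite [X in _ = X + _ + _]mulmxDl [X in _ = X + _ + _ + _]mulmxDl.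
  rewrite [parP0 t *m (z1 - z2)]mulmxBr.
  have := sum_slope (parP t) (parq t) nu1 nu2 z1 z2.
  have := sum_slope (parD t) (parh t) la1 la2 z1 z2.
  set E1 := \sum_i la1 i 0 *: _; set E2 := \sum_i la2 i 0 *: _.
  set S1 := \sum_i nu1 i 0 *: _; set S2 := \sum_i nu2 i 0 *: _.
  set X := _ *m _; set Y := \sum_i _ *: _ => EX.
  set X' := _ *m _; set Y' := \sum_i _ *: _ => SX.
  rewrite [_ + X' + X + Y']addrAC -[_ + X' + Y']addrA -SX -[_ + X + Y]addrA -EX.
  rewrite opprD addrACA; congr (_ + _).
  rewrite opprD addrACA; congr (_ + _).
  by rewrite opprD addrACA subrr addr0.
- apply/colP => i; rewrite !mxE.
  have := quad_slopeE (parP t i) (parq t i) (parr t i) z1 z2.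
  rewrite -/(ineq t i z1) -/(ineq t i z2) => <-; ring.
- apply/colP => i; rewrite !mxE -(quad_slopeE _ _ (parg t i)).
  by [].
Qed.

Lemma parP0_linear a t t' : parP0 (a *: t + t') = a *: parP0 t + parP0 t'.
Proof. by []. Qed.
Lemma parq0_linear a t t' : parq0 (a *: t + t') = a *: parq0 t + parq0 t'.
Proof. by []. Qed.
Lemma parP_linear i a t t' : parP (a *: t + t') i = a *: parP t i + parP t' i.
Proof. by rewrite /parP /= !linearP. Qed.
Lemma parq_linear i a t t' : parq (a *: t + t') i = a *: parq t i + parq t' i.
Proof. by rewrite /parq /= !linearP. Qed.
Lemma parr_linear i a t t' : parr (a *: t + t') i = a * parr t i + parr t' i.
Proof. by rewrite /parr /= !mxE. Qed.
Lemma parD_linear i a t t' : parD (a *: t + t') i = a *: parD t i + parD t' i.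
Proof. by rewrite /parD /= !linearP. Qed.
Lemma parh_linear i a t t' : parh (a *: t + t') i = a *: parh t i + parh t' i.
Proof. by rewrite /parh /= !linearP. Qed.
Lemma parg_linear i a t t' : parg (a *: t + t') i = a * parg t i + parg t' i.
Proof. by rewrite /parg /= !mxE. Qed.

Lemma quad_linear a (P P' : 'M[R]_k) q q' r r' z :
  quad (a *: P + P') (a *: q + q') (a * r + r') z
  = a * quad P q r z + quad P' q' r' z.
Proof.
rewrite /quad [(a *: q + q')^T]linearP /= mulmxDr !mulmxDl -scalemxAr.
by rewrite -!scalemxAl !(scalD, scalZ); ring.
Qed.

Lemma ineq_linear i z a t t' : ineq (a *: t + t') i z = a * ineq t i z + ineq t' i z.
Proof. by rewrite /ineq parP_linear parq_linear parr_linear quad_linear. Qed.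

Lemma equa_linear i z a t t' : equa (a *: t + t') i z = a * equa t i z + equa t' i z.
Proof. by rewrite /equa parD_linear parh_linear parg_linear quad_linear. Qed.

Lemma sum_linear m (n : 'cV[R]_m) a (Q Q' : 'I_m -> 'M[R]_k)
    (c c' : 'I_m -> 'cV[R]_k) z :
  \sum_i n i 0 *: ((a *: Q i + Q' i) *m z + (a *: c i + c' i)) =
  a *: (\sum_i n i 0 *: (Q i *m z + c i)) + \sum_i n i 0 *: (Q' i *m z + c' i).
Proof.
rewrite scaler_sumr -big_split; apply: eq_bigr => i _ /=.
rewrite mulmxDl -scalemxAl addrACA -scalerDr [LHS]scalerDr.
by rewrite !scalerA mulrC.
Qed.

Lemma kkt_res_linear w : linear (kkt_res w).
Proof.
move=> a t t'; rewrite /kkt_res !scale_col_mx !add_col_mx.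
congr (col_mx (col_mx _ _) _).
- under eq_bigr do rewrite parP_linear parq_linear.
  under [X in _ + X = _]eq_bigr do rewrite parD_linear parh_linear.
  rewrite !sum_linear parP0_linear parq0_linear mulmxDl -scalemxAl.
  rewrite !scalerDr.
  rewrite [RHS]addrACA; congr (_ + _); rewrite [RHS]addrACA; congr (_ + _).
  by rewrite addrACA.
- by apply/colP => i; rewrite !mxE ineq_linear; ring.
- by apply/colP => i; rewrite !mxE equa_linear.
Qed.

HB.instance Definition _ w := GRing.isLinear.Build R qcqp
  'cV[R]_(k + mI + mE) _ (kkt_res w) (kkt_res_linear w).

Section Continuity.
Context {T : Type} {F : set_system T} {FF : Filter F}.
Variables (s : T -> qcqp) (t : qcqp).
Hypothesis st : s x @[x --> F] --> t.

Let st1 : (s x).1.1 @[x --> F] --> t.1.1.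
Proof. by apply: cvg_fst_nbhs; apply: cvg_fst_nbhs. Qed.

Let st2 : (s x).1.2 @[x --> F] --> t.1.2.
Proof. by apply: cvg_snd_nbhs; apply: cvg_fst_nbhs. Qed.

Let st3 : (s x).2 @[x --> F] --> t.2.
Proof. exact: cvg_snd_nbhs. Qed.

Lemma cvg_parP0 : parP0 (s x) @[x --> F] --> parP0 t.
Proof. exact: cvg_fst_nbhs. Qed.

Lemma cvg_parq0 : parq0 (s x) @[x --> F] --> parq0 t.
Proof. exact: cvg_snd_nbhs. Qed.

Lemma cvg_parP i : parP (s x) i @[x --> F] --> parP t i.
Proof.
apply: cvg_mx => a b; under eq_fun do rewrite !mxE.
rewrite !mxE; apply: cvg_entry; apply: cvg_fst_nbhs; exact: cvg_fst_nbhs.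
Qed.

Lemma cvg_parq i : parq (s x) i @[x --> F] --> parq t i.
Proof.
apply: cvg_mx => a b; under eq_fun do rewrite !mxE.
rewrite !mxE; apply: cvg_entry; apply: cvg_snd_nbhs; exact: cvg_fst_nbhs.
Qed.

Lemma cvg_parr i : parr (s x) i @[x --> F] --> parr t i.
Proof. by apply: cvg_entry; apply: cvg_snd_nbhs. Qed.

Lemma cvg_parD i : parD (s x) i @[x --> F] --> parD t i.
Proof.
apply: cvg_mx => a b; under eq_fun do rewrite !mxE.
rewrite !mxE; apply: cvg_entry; apply: cvg_fst_nbhs; exact: cvg_fst_nbhs.
Qed.

Lemma cvg_parh i : parh (s x) i @[x --> F] --> parh t i.
Proof.
apply: cvg_mx => a b; under eq_fun do rewrite !mxE.
rewrite !mxE; apply: cvg_entry; apply: cvg_snd_nbhs; exact: cvg_fst_nbhs.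
Qed.

Lemma cvg_parg i : parg (s x) i @[x --> F] --> parg t i.
Proof. by apply: cvg_entry; apply: cvg_snd_nbhs. Qed.

Lemma cvg_ineq i (zs : T -> 'cV[R]_k) z : zs x @[x --> F] --> z ->
  ineq (s x) i (zs x) @[x --> F] --> ineq t i z.
Proof.
by apply: cvg_quad; [exact: cvg_parP|exact: cvg_parq|exact: cvg_parr].
Qed.

Lemma cvg_equa i (zs : T -> 'cV[R]_k) z : zs x @[x --> F] --> z ->
  equa (s x) i (zs x) @[x --> F] --> equa t i z.
Proof.
by apply: cvg_quad; [exact: cvg_parD|exact: cvg_parh|exact: cvg_parg].
Qed.

Lemma cvg_lagrangian_hess (nus : T -> 'cV[R]_mI) nu (las : T -> 'cV[R]_mE) la :
  nus x @[x --> F] --> nu -> las x @[x --> F] --> la ->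
  parP0 (s x) + \sum_i nus x i 0 *: parP (s x) i
    + \sum_i las x i 0 *: parD (s x) i @[x --> F] -->
  parP0 t + \sum_i nu i 0 *: parP t i + \sum_i la i 0 *: parD t i.
Proof.
move=> nun lal; apply: cvgD.
  apply: cvgD; first exact: cvg_parP0.
  by apply: cvg_sumr => i; apply: cvgZ; [exact: cvg_entry|exact: cvg_parP].
by apply: cvg_sumr => i; apply: cvgZ; [exact: cvg_entry|exact: cvg_parD].
Qed.

Lemma cvg_kkt_slope (zs1 zs2 : T -> 'cV[R]_k) z1 z2
    (nus : T -> 'cV[R]_mI) nu (las : T -> 'cV[R]_mE) la :
  zs1 x @[x --> F] --> z1 -> nus x @[x --> F] --> nu ->
  las x @[x --> F] --> la -> zs2 x @[x --> F] --> z2 ->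
  kkt_slope (s x) (zs1 x) (nus x) (las x) (zs2 x) @[x --> F] -->
  kkt_slope t z1 nu la z2.
Proof.
move=> z1P nuP laP z2P.
rewrite /kkt_slope; apply: cvg_block_mx; last exact: cvg_cst.
- apply: cvg_block_mx.
  + exact: cvg_lagrangian_hess.
  + apply: cvg_mx => a i; under eq_fun do rewrite mxE.
    rewrite mxE; apply: cvg_entry; apply: cvgD; last exact: cvg_parq.
    by apply: cvg_mulmx => //; exact: cvg_parP.
  + apply: cvg_mx => i a; under eq_fun do rewrite mxE.
    rewrite mxE; apply: cvg_entry; apply: cvgZ; first exact: cvg_entry.
    by apply: cvg_quad_slope => //; [exact: cvg_parP|exact: cvg_parq].
  + apply: cvg_mx => i j; under eq_fun do rewrite !mxE.
    rewrite !mxE; case: (i == j); last exact: cvg_cst.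
    exact: cvg_ineq.
- apply: cvg_col_mx; last exact: cvg_cst.
  apply: cvg_mx => a i; under eq_fun do rewrite mxE.
  rewrite mxE; apply: cvg_entry; apply: cvgD; last exact: cvg_parh.
  by apply: cvg_mulmx => //; exact: cvg_parD.
- apply: cvg_row_mx; last exact: cvg_cst.
  apply: cvg_mx => i a; under eq_fun do rewrite mxE.
  rewrite mxE; apply: cvg_entry.
  by apply: cvg_quad_slope => //; [exact: cvg_parD|exact: cvg_parh].
Qed.

Lemma cvg_kkt_res w : kkt_res w (s x) @[x --> F] --> kkt_res w t.
Proof.
apply: cvg_col_mx; [apply: cvg_col_mx|].
- apply: cvgD; last first.
    apply: cvg_sumr => i; apply: cvgZ; first exact: cvg_cst.
    apply: cvgD; last exact: cvg_parh.
    by apply: cvg_mulmx; [exact: cvg_parD|exact: cvg_cst].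
  apply: cvgD; last first.
    apply: cvg_sumr => i; apply: cvgZ; first exact: cvg_cst.
    apply: cvgD; last exact: cvg_parq.
    by apply: cvg_mulmx; [exact: cvg_parP|exact: cvg_cst].
  apply: cvgD; last exact: cvg_parq0.
  by apply: cvg_mulmx; [exact: cvg_parP0|exact: cvg_cst].
- apply: cvg_mx => i j; under eq_fun do rewrite mxE.
  rewrite mxE; apply: cvgM; first exact: cvg_cst.
  by apply: cvg_ineq; exact: cvg_cst.
- apply: cvg_mx => i j; under eq_fun do rewrite mxE.
  by rewrite mxE; apply: cvg_equa; exact: cvg_cst.
Qed.

End Continuity.

End KktSystem.

(** * The Lagrangian as a quadratic, and invertibility of the KKT matrix *)

Section Lagrangian.
Context {R : realType} {k mI mE : nat}.
Notation qcqp := (qcqp R k mI mE).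
Implicit Types (t : qcqp) (z u : 'cV[R]_k) (nu : 'cV[R]_mI) (la : 'cV[R]_mE).

(** This is the block M11. The true Hessian is its symmetric part, hence the symmetry assumption in
    [hess_lagrangian]. *)
Definition lag_hess t nu la : 'M[R]_k :=
  parP0 t + \sum_i nu i 0 *: parP t i + \sum_i la i 0 *: parD t i.

Lemma sum_quad m (n : 'cV[R]_m) (P : 'I_m -> 'M[R]_k) (q : 'I_m -> 'cV[R]_k)
    (r : 'I_m -> R) z :
  \sum_i n i 0 * quad (P i) (q i) (r i) z =
  quad (\sum_i n i 0 *: P i) (\sum_i n i 0 *: q i) (\sum_i n i 0 * r i) z.
Proof.
elim: (index_enum _) => [|i s IH].
  by rewrite !big_nil /quad /scal mulmx0 mul0mx trmx0 mul0mx !mxE; ring.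
by rewrite !big_cons quad_linear IH.
Qed.

Definition lag_lin t nu la : 'cV[R]_k :=
  parq0 t + \sum_i nu i 0 *: parq t i + \sum_i la i 0 *: parh t i.

(** As a single quadratic, the Lagrangian has an exact second-order expansion through [quadD]. *)
Lemma lagrangianE t nu la : lagrangian t nu la =
  quad (lag_hess t nu la) (lag_lin t nu la)
    (\sum_i nu i 0 * parr t i + \sum_i la i 0 * parg t i).
Proof.
have quadDr P P' q q' r r' z : quad P q r z + quad P' q' r' z =
    quad (P + P') (q + q') (r + r') z :> R.
  by have := quad_linear 1 P P' q q' r r' z; rewrite !scale1r !mul1r.
apply: funext => z; rewrite /lagrangian /objective !sum_quad !quadDr.
by rewrite add0r.
Qed.

Lemma lag_hess_sym t nu la :
  symmetric_params t -> (lag_hess t nu la)^T = lag_hess t nu la.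
Proof.
move=> [P0s Ps Ds]; rewrite /lag_hess !linearD /= P0s !linear_sum /=.
congr (_ + _ + _); apply: eq_bigr => i _; rewrite linearZ /=.
  by rewrite Ps.
by rewrite Ds.
Qed.

Lemma hess_lagrangian t nu la z : symmetric_params t ->
  hess (lagrangian t nu la) z = lag_hess t nu la.
Proof.
move=> ts; rewrite lagrangianE hess_quad lag_hess_sym// -mulr2n.
rewrite -[lag_hess _ _ _ *+ 2]scaler_nat.
by rewrite scalerA mulVf ?pnatr_eq0// scale1r.
Qed.

Lemma grad_lagrangian0 t nu la z : symmetric_params t -> kkt t z nu la ->
  quad_slope (lag_hess t nu la) (lag_lin t nu la) z z = 0.
Proof.
move=> ts [st _ _]; rewrite quad_slope_sym ?lag_hess_sym// -[RHS]trmx0 -st.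
congr (_^T); rewrite /lag_hess /lag_lin !mulmxDl !mulmx_suml.
rewrite addrACA [X in X + _ = _]addrACA -!big_split /=.
by congr (_ + _ + _); apply: eq_bigr => i _; rewrite scalerDr scalemxAl.
Qed.

Lemma constraint_jac_mul0 t z u :
  (forall i, i \in active t z ->
    scal (quad_slope (parP t i) (parq t i) z z *m u) = 0) ->
  (forall i, scal (quad_slope (parD t i) (parh t i) z z *m u) = 0) ->
  constraint_jac t z *m u = 0.
Proof.
move=> Iu Eu; rewrite /constraint_jac mul_col_mx !mulmx_rows -col_mx0.
congr col_mx; apply/colP => i; rewrite !mxE grad_quad trmxK.
  by apply: Iu; exact: enum_valP.
exact: Eu.
Qed.

(** Coefficients that vanish off the active set amount to a row vector [v] acting on
    [constraint_jac], whose rows are independent. *)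
Lemma licq_free t z (a : 'cV[R]_mI) (b : 'cV[R]_mE) : licq t z ->
  (forall i, i \notin active t z -> a i 0 = 0) ->
  \sum_i a i 0 *: quad_slope (parP t i) (parq t i) z z
    + \sum_i b i 0 *: quad_slope (parD t i) (parh t i) z z = 0 ->
  a = 0 /\ b = 0.
Proof.
move=> /row_free_inj inj a0 sum0.
pose v := row_mx (\row_(j < #|active t z|) a (enum_val j) 0) b^T.
have : v *m constraint_jac t z = 0.
  rewrite mul_row_col !mulmx_sum_row -[RHS]sum0; congr (_ + _).
    rewrite [RHS](bigID (mem (active t z))) /= [X in _ + X]big1 ?addr0; last first.
      by move=> i /a0 ->; rewrite scale0r.
    rewrite [RHS]big_enum_val; apply: eq_bigr => j _.
    by rewrite rowK mxE grad_quad trmxK.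
  by apply: eq_bigr => j _; rewrite rowK mxE grad_quad trmxK.
rewrite -(mul0mx _ (constraint_jac t z)) => /inj v0.
move: v0; rewrite /v -row_mx0 => /eq_row_mx[va vb]; split.
  apply/colP => i; rewrite [RHS]mxE; have [iA|/a0//] := boolP (i \in active t z).
  have := congr1 (fun M : 'rV_#|active t z| => M 0 (enum_rank_in iA i)) va.
  by rewrite !mxE enum_rankK_in.
by rewrite -[b]trmxK vb trmx0.
Qed.

(** Let [(u, a, b)] be in the kernel. The last two block rows and strict complementarity put [u] in
    the null space of the constraint Jacobian and [a] on the active set. Pairing the first block row
    with [u] leaves only the curvature term, so [u = 0] by the second-order condition; constraint
    qualification then gives [a = b = 0]. *)
Lemma kkt_mx_unit t z nu la : symmetric_params t -> kkt t z nu la ->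
  strict_complementarity t z nu -> licq t z ->
  second_order_sufficient t z nu la -> kkt_mx t z nu la \in unitmx.
Proof.
move=> ts tkkt [nupos nu0] cq sosc.
(* Transposing turns the row-kernel criterion into a statement on column vectors [w] with
   [M w = 0]. *)
rewrite -unitmx_tr -row_free_unit; apply/inj_row_free => v.
move=> /(congr1 trmx); rewrite trmx_mul trmxK trmx0 => vM.
suff : v^T = 0 by move=> /(congr1 trmx); rewrite trmxK trmx0.
move: (v^T) vM => {v} w; rewrite -[w]vsubmxK -[usubmx w]vsubmxK.
set u := usubmx _; set a := dsubmx _; set b := dsubmx _.
rewrite -kkt_slope_diag mul_kkt_slope -!col_mx0 => /eq_col_mx[/eq_col_mx[e1 e2] e3].
have Eu i : scal (quad_slope (parD t i) (parh t i) z z *m u) = 0.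
  by have := congr1 (fun M : 'cV_mE => M i 0) e3; rewrite !mxE.
have e2i i : nu i 0 * scal (quad_slope (parP t i) (parq t i) z z *m u)
      + ineq t i z * a i 0 = 0.
  by have := congr1 (fun M : 'cV_mI => M i 0) e2; rewrite !mxE.
have Iu i : i \in active t z ->
    scal (quad_slope (parP t i) (parq t i) z z *m u) = 0.
  move=> iA; have /eqP := e2i i; move: (iA); rewrite inE => /eqP ->.
  by rewrite mul0r addr0 mulf_eq0 gt_eqF ?nupos//= => /eqP.
have a0 i : i \notin active t z -> a i 0 = 0.
  move=> iA; have /eqP := e2i i; rewrite nu0// mul0r add0r mulf_eq0.
  by move: iA; rewrite inE => /negbTE -> /eqP.
have [_ Ps Ds] := ts.
have scal0 (c : 'M[R]_1) : scal c = 0 -> c = 0.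
  by move=> c0; apply/matrixP => i j; rewrite !ord1 mxE.
have gP i : parP t i *m z + parq t i =
    (quad_slope (parP t i) (parq t i) z z)^T.
  by rewrite quad_slope_sym ?trmxK.
have gD i : parD t i *m z + parh t i =
    (quad_slope (parD t i) (parh t i) z z)^T.
  by rewrite quad_slope_sym ?trmxK.
have sumE : u^T *m (\sum_i a i 0 *: (parP t i *m z + parq t i)
      + \sum_i b i 0 *: (parD t i *m z + parh t i)) = 0.
  rewrite mulmxDr !mulmx_sumr !big1 ?addr0// => i _.
    by rewrite -scalemxAr gD -trmx_mul (scal0 _ (Eu i)) trmx0 scaler0.
  have [iA|/a0 ->] := boolP (i \in active t z); last by rewrite scale0r mulmx0.
  by rewrite -scalemxAr gP -trmx_mul (scal0 _ (Iu i iA)) trmx0 scaler0.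
have u0 : u = 0.
  apply/eqP; apply: contraT => un0.
  have := sosc u (constraint_jac_mul0 Iu Eu) un0.
  rewrite hess_lagrangian// -mulmxA.
  have := congr1 (mulmx u^T) e1; rewrite -addrA mulmxDr sumE addr0 => ->.
  by rewrite mulmx0 /scal mxE ltxx.
have [a_0 b_0] : a = 0 /\ b = 0.
  apply: (licq_free cq a0).
  apply: trmx_inj; rewrite trmx0 linearD !linear_sum /= -[RHS]e1 u0 mulmx0 add0r.
  by congr (_ + _); apply: eq_bigr => i _; rewrite linearZ /= (gP, gD).
by rewrite u0 a_0 b_0 !col_mx0.
Qed.

End Lagrangian.

(** * Strict local optimality along the branch, by compactness of the unit sphere *)

Lemma compact_sphere {R : realType} n : compact [set x : 'rV[R]_n | `|x| = 1].
Proof.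
apply: bounded_closed_compact.
  by exists 1; split => [|M M1 x /= ->]; [exact: num_real|exact: ltW].
rewrite (_ : mkset _ = (fun x : 'rV[R]_n => `|x|) @^-1` [set 1])//.
apply: preimage_closed; last exact: closed_eq.
by move=> x _; exact: norm_continuous.
Qed.

Section StrictOptimality.
Context {R : realType} {k mI mE : nat}.
Notation qcqp := (qcqp R k mI mE).
Notation point := (qcqp * ('cV[R]_k * 'cV[R]_mI * 'cV[R]_mE) * R)%type.
Implicit Types (t : qcqp) (z u : 'cV[R]_k) (nu : 'cV[R]_mI) (la : 'cV[R]_mE).

(* A point is (t, (z, nu, la), rho); by [quad_slopeE] the constraints vary by
   rho times the rates below when z moves to z + rho v. *)
Definition ineq_rate (p : point) i (v : 'cV[R]_k) : R :=
  scal (quad_slope (parP p.1.1 i) (parq p.1.1 i)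
    (p.2 *: v + p.1.2.1.1) p.1.2.1.1 *m v).

Definition equa_rate (p : point) i (v : 'cV[R]_k) : R :=
  scal (quad_slope (parD p.1.1 i) (parh p.1.1 i)
    (p.2 *: v + p.1.2.1.1) p.1.2.1.1 *m v).

Definition curvature (p : point) (v : 'cV[R]_k) : R :=
  scal (v^T *m lag_hess p.1.1 p.1.2.1.2 p.1.2.2 *m v).

(* Every alternative is open in (p, v), and each one either contradicts the
   feasibility of z + rho v or makes it worse than z. *)
Definition no_descent (A : {set 'I_mI}) (p : point) (v : 'cV[R]_k) : Prop :=
  [\/ exists i, equa_rate p i v != 0,
      exists2 i, i \in A & 0 < ineq_rate p i v,
      0 < 2^-1 * p.2 * curvature p v
          - \sum_(i in A) p.1.2.1.2 i 0 * ineq_rate p i v |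
      0 < curvature p v].

(** Each direction gets its own neighbourhood from whichever alternative holds strictly at the base
    point; compactness makes the neighbourhood of the parameters uniform in the direction. *)
Lemma no_descent_near t z nu la :
  symmetric_params t -> (forall i, i \in active t z -> 0 < nu i 0) ->
  second_order_sufficient t z nu la ->
  \forall p \near (t, (z, nu, la), 0 : R),
    forall x : 'rV[R]_k, `|x| = 1 -> no_descent (active t z) p x^T.
Proof.
move=> ts nupos sosc; set A := active t z.
set p0 : point := (t, (z, nu, la), 0).
have /compact_near_coveringP cov := @compact_sphere R k.
suff H (x : 'rV[R]_k) : `|x| = 1 ->
    \forall y \near (x, p0), no_descent A y.2 y.1^T.
  have := cov point (nbhs p0) (fun p x => no_descent A p x^T) _ H.
  by apply.
move=> x1.
have idc : y @[y --> (x, p0)] --> (x, p0) by exact: cvg_id.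
have xc : y.1^T @[y --> (x, p0)] --> x^T.
  exact: cvg_trmx (cvg_fst_nbhs idc).
have pc := cvg_snd_nbhs idc.
have tc := cvg_fst_nbhs (cvg_fst_nbhs pc).
have rc := cvg_snd_nbhs pc.
have sc := cvg_snd_nbhs (cvg_fst_nbhs pc).
have zc := cvg_fst_nbhs (cvg_fst_nbhs sc).
have nuc := cvg_snd_nbhs (cvg_fst_nbhs sc).
have lac := cvg_snd_nbhs sc.
have zrc : y.2.2 *: y.1^T + y.2.1.2.1.1 @[y --> (x, p0)] --> 0 *: x^T + z.
  by apply: cvgD => //; apply: cvgZ.
have Ec i : equa_rate y.2 i y.1^T @[y --> (x, p0)] --> equa_rate p0 i x^T.
  apply: cvg_entry; apply: cvg_mulmx => //.
  by apply: cvg_quad_slope => //; [exact: cvg_parD|exact: cvg_parh].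
have Ic i : ineq_rate y.2 i y.1^T @[y --> (x, p0)] --> ineq_rate p0 i x^T.
  apply: cvg_entry; apply: cvg_mulmx => //.
  by apply: cvg_quad_slope => //; [exact: cvg_parP|exact: cvg_parq].
have Cc : curvature y.2 y.1^T @[y --> (x, p0)] --> curvature p0 x^T.
  apply: cvg_entry; apply: cvg_mulmx => //; apply: cvg_mulmx => //.
    exact: cvg_trmx.
  exact: cvg_lagrangian_hess.
have [[i Ei]|noE] := pselect (exists i, equa_rate p0 i x^T != 0).
  by apply: filterS (cvgr_neq0 _ (Ec i) Ei) => y ?; constructor 1; exists i.
have [[i iA Ii]|noI] := pselect (exists2 i, i \in A & 0 < ineq_rate p0 i x^T).
  by apply: filterS (cvgr_gt _ (Ic i) _ Ii) => y ?; constructor 2; exists i.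
have I_le0 i : i \in A -> ineq_rate p0 i x^T <= 0.
  by move=> iA; rewrite leNgt; apply/negP => Ii; apply: noI; exists i.
(* All active rates are now nonpositive. At rho = 0 the curvature term disappears, so one negative
   rate with its positive multiplier makes the third expression positive. *)
have [[i iA Ii]|noI'] := pselect (exists2 i, i \in A & ineq_rate p0 i x^T < 0).
  have : 2^-1 * y.2.2 * curvature y.2 y.1^T
      - \sum_(i in A) y.2.1.2.1.2 i 0 * ineq_rate y.2 i y.1^T
      @[y --> (x, p0)] --> 2^-1 * 0 * curvature p0 x^T
      - \sum_(i in A) nu i 0 * ineq_rate p0 i x^T.
    apply: cvgB.
      by apply: cvgM => //; apply: cvgM => //; exact: cvg_cst.
    apply: cvg_sumr => j; apply: cvgM => //; exact: cvg_entry.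
  move=> /cvgr_gt gt; apply: filterS (gt 0 _) => [y|]; first by constructor 3.
  rewrite mulr0 mul0r sub0r oppr_gt0 (bigD1 i)//= -[ltRHS]addr0 ltr_leD//.
    by rewrite pmulr_rlt0// nupos.
  by apply: sumr_le0 => j /andP[jA _]; rewrite pmulr_rle0 ?I_le0// nupos.
(* All active and equality rates vanish, so the direction is a nonzero vector of the null space in
   the second-order condition. *)
have H0 : 0 < curvature p0 x^T.
  rewrite /curvature -(hess_lagrangian _ _ z)//.
  apply: sosc.
    apply: constraint_jac_mul0 => i.
      move=> iA; apply/eqP; rewrite eq_le.
      have := I_le0 i iA; rewrite /ineq_rate /= scale0r add0r => -> /=.
      rewrite leNgt; apply/negP => Ii; apply: noI'; exists i => //.
      by rewrite /ineq_rate /= scale0r add0r.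
    apply/eqP; apply: contra_notT noE => Ei; exists i.
    by rewrite /equa_rate /= scale0r add0r.
  apply/eqP => x0; move: x1; rewrite -[x]trmxK x0 trmx0 normr0 => /eqP.
  by rewrite eq_sym oner_eq0.
by apply: filterS (cvgr_gt _ Cc _ H0) => y ?; constructor 4.
Qed.

(** [A] is any set of indices with positive multipliers, not necessarily the active set of [t]: the
    active set of the unperturbed program can thus be used for all nearby parameters. *)
Lemma no_descent_lt t z nu la (A : {set 'I_mI}) w (r : R) (v : 'cV[R]_k) :
  symmetric_params t -> kkt t z nu la -> (forall i, i \in A -> 0 < nu i 0) ->
  feasible t w -> 0 < r -> w = r *: v + z -> no_descent A (t, (z, nu, la), r) v ->
  objective t z < objective t w.
Proof.
move=> ts tkkt nupos [Iw Ew] r0 wE.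
have [_ Iz Ez] := tkkt.
have wz : w - z = r *: v by rewrite wE addrK.
pose p : point := (t, (z, nu, la), r).
have Erate i : equa_rate p i v = 0.
  have := quad_slopeE (parD t i) (parh t i) (parg t i) w z.
  rewrite -!/(equa _ _ _) Ew Ez subrr wz -scalemxAr scalZ {1}wE => /esym/eqP.
  by rewrite mulf_eq0 gt_eqF//= => /eqP.
(* A positive multiplier forces [ineq t i z = 0] by complementarity. *)
have Irate i : i \in A -> ineq t i w = r * ineq_rate p i v.
  move=> iA; have := quad_slopeE (parP t i) (parq t i) (parr t i) w z.
  rewrite -!/(ineq _ _ _) wz -scalemxAr scalZ {2}wE => <-.
  have [_ _ /eqP] := Iz i; rewrite mulf_eq0 gt_eqF ?nupos//= => /eqP ->.
  by rewrite subr0.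
(* Compare the Lagrangian at w and z: it has no first order term at z. *)
have objE : objective t w = objective t z + 2^-1 * r ^+ 2 * curvature p v
    - \sum_i nu i 0 * ineq t i w.
  have : lagrangian t nu la w = lagrangian t nu la z + 2^-1 * r ^+ 2 * curvature p v.
    rewrite lagrangianE [in LHS]wE [_ + z]addrC quadD grad_lagrangian0// mul0mx.
    rewrite [scal 0]mxE addr0 [(r *: v)^T]linearZ /= -!scalemxAl -scalemxAr.
    by rewrite !scalZ /curvature; ring.
  rewrite /lagrangian [X in _ + X = _]big1 => [|i _]; last by rewrite Ew mulr0.
  rewrite [X in _ = _ + X + _ + _]big1 => [|i _]; last by have [_ _ ->] := Iz i.
  rewrite [X in _ = _ + X + _]big1 => [|i _]; last by rewrite Ez mulr0.
  by rewrite !addr0 => <-; rewrite addrK.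
have nuI_le0 i : nu i 0 * ineq t i w <= 0.
  by have [_ nu0 _] := Iz i; rewrite mulr_ge0_le0.
(* Terms outside [A] are nonpositive and may be dropped from the upper bound. *)
have sumA : \sum_i nu i 0 * ineq t i w
    <= r * \sum_(i in A) nu i 0 * ineq_rate p i v.
  rewrite (bigID (mem A)) /= -[leRHS]addr0 lerD ?sumr_le0// mulr_sumr.
  by rewrite ler_sum// => i iA; rewrite (Irate i iA) mulrCA.
case=> /=.
- by case=> i /eqP; rewrite Erate.
- case=> i iA; rewrite -(pmulr_rgt0 _ r0) -Irate// ltNge.
  by rewrite Iw.
- rewrite -/p -(pmulr_rgt0 _ r0) mulrBr objE => H.
  have : r * (2^-1 * r * curvature p v) = 2^-1 * r ^+ 2 * curvature p v by ring.
  by lra.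
- rewrite -/p objE => c0.
  have : 0 < 2^-1 * r ^+ 2 * curvature p v.
    by rewrite !mulr_gt0 ?invr_gt0// exprn_gt0.
  have : \sum_i nu i 0 * ineq t i w <= 0 by apply: sumr_le0.
  by lra.
Qed.

Lemma strict_optimal_near t z nu la
    (s : qcqp -> 'cV[R]_k * 'cV[R]_mI * 'cV[R]_mE) :
  symmetric_params t -> (forall i, i \in active t z -> 0 < nu i 0) ->
  second_order_sufficient t z nu la ->
  s t = (z, nu, la) -> {for t, continuous s} ->
  (\forall t' \near t, kkt t' (s t').1.1 (s t').1.2 (s t').2) ->
  exists2 W, nbhs z W & \forall t' \near t,
    symmetric_params t' -> strict_optimal_within W t' (s t').1.1.
Proof.
move=> ts nupos sosc st s_cont s_kkt.
have sc : s t' @[t' --> t] --> (z, nu, la) by rewrite -st.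
(* The distance to the branch point serves as rho; it tends to 0 at [(t, z)]. The transpose matches
   the sphere of row vectors. *)
pose rad (q : qcqp * 'cV[R]_k) : R := `|(q.2 - (s q.1).1.1)^T|.
have : \forall q \near (t, z), forall x : 'rV[R]_k, `|x| = 1 ->
    no_descent (active t z) (q.1, s q.1, rad q) x^T.
  have /= := no_descent_near ts nupos sosc.
  have : (q.1, s q.1, rad q) @[q --> (t, z)] --> (t, (z, nu, la), 0 : R).
    have qc : q @[q --> (t, z)] --> (t, z) by exact: cvg_id.
    have sqc : s q.1 @[q --> (t, z)] --> (z, nu, la).
      by apply: cvg_comp sc; exact: cvg_fst_nbhs qc.
    apply: cvg_pair_nbhs; first apply: cvg_pair_nbhs => //.
      exact: cvg_fst_nbhs qc.
    rewrite (_ : 0 = `|(z - z)^T| :> R); last by rewrite subrr trmx0 normr0.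
    apply: cvg_norm; apply: cvg_trmx; apply: cvgB; first exact: cvg_snd_nbhs qc.
    exact: cvg_fst_nbhs (cvg_fst_nbhs sqc).
  by move=> c; apply: c.
(* Splitting a product neighbourhood of [(t, z)] yields a [W] independent of [t']. *)
move=> [[U W] /= [Ut Wz] UW]; exists W => //.
have zc := cvg_fst_nbhs (cvg_fst_nbhs sc).
have nuc := cvg_snd_nbhs (cvg_fst_nbhs sc).
near=> t' => ts'.
have kkt' : kkt t' (s t').1.1 (s t').1.2 (s t').2 by near: t'.
split.
- by near: t'; exact: zc.
- by have [_ Iz Ez] := kkt'; split => // i; have [] := Iz i.
- move=> w Ww wfeas wz.
  have Ut' : U t' by near: t'.
  have r0 : 0 < rad (t', w).
    by rewrite normr_gt0 trmx_eq0 subr_eq0.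
  have := UW (t', w) (conj Ut' Ww) ((rad (t', w))^-1 *: (w - (s t').1.1)^T).
  rewrite normrZ normfV ger0_norm ?mulVf ?gt_eqF//; last exact: ltW.
  move=> /(_ erefl) nd.
  apply: (@no_descent_lt _ _ _ _ _ _ _ _ ts' kkt' _ wfeas r0 _ _); last first.
  + by move: nd; rewrite /= -!surjective_pairing; apply.
  + by rewrite linearZ /= trmxK scalerA mulfV ?gt_eqF// scale1r subrK.
  + near: t'; apply: filter_forall => i.
    have [iA|iA] := boolP (i \in active t z); last by apply: nearW.
    have H : \forall x \near t, 0 < (s x).1.2 i 0.
      exact: (cvgr_gt _ (cvg_entry (i := i) (j := 0) nuc) _ (nupos i iA)).
    by apply: filterS H => x ? _.
Unshelve. all: by end_near. Qed.

End StrictOptimality.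

(** * Existence and differentiability of the solution branch, and the derivative of the loss *)

Section SolutionBranch.
Context {R : realType} {k mI mE : nat}.
Notation qcqp := (qcqp R k mI mE).
Notation triple := ('cV[R]_k * 'cV[R]_mI * 'cV[R]_mE)%type.
Implicit Types (t : qcqp) (z u : 'cV[R]_k) (nu : 'cV[R]_mI) (la : 'cV[R]_mE).

Definition pack (p : triple) : 'cV[R]_(k + mI + mE) :=
  col_mx (col_mx p.1.1 p.1.2) p.2.

Definition unpack (w : 'cV[R]_(k + mI + mE)) : triple :=
  (usubmx (usubmx w), dsubmx (usubmx w), dsubmx w).

Lemma packK : cancel pack unpack.
Proof. by case=> [[z nu] la]; rewrite /pack /unpack !(col_mxKu, col_mxKd). Qed.

Lemma unpackK : cancel unpack pack.
Proof. by move=> w; rewrite /pack /unpack /= !vsubmxK. Qed.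

Lemma cvg_pack {T : Type} {F : set_system T} {FF : Filter F} (s : T -> triple)
    (p : triple) : s x @[x --> F] --> p -> pack (s x) @[x --> F] --> pack p.
Proof.
move=> sp; apply: cvg_col_mx; last exact: cvg_snd_nbhs.
apply: cvg_col_mx; first exact: cvg_fst_nbhs (cvg_fst_nbhs sp).
exact: cvg_snd_nbhs (cvg_fst_nbhs sp).
Qed.

Lemma cvg_unpack {T : Type} {F : set_system T} {FF : Filter F}
    (s : T -> 'cV[R]_(k + mI + mE)) w :
  s x @[x --> F] --> w -> unpack (s x) @[x --> F] --> unpack w.
Proof.
move=> sw; apply: cvg_pair_nbhs; last exact: cvg_dsubmx.
by apply: cvg_pair_nbhs; [apply: cvg_usubmx|apply: cvg_dsubmx]; apply: cvg_usubmx.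
Qed.

Lemma kkt_res0 t (p : triple) : kkt t p.1.1 p.1.2 p.2 -> kkt_res (pack p) t = 0.
Proof.
case: p => [[z nu] la] /= [st Iz Ez]; rewrite /kkt_res !(col_mxKu, col_mxKd) /= st.
rewrite -!col_mx0; congr (col_mx (col_mx _ _) _); apply/colP => i; rewrite !mxE.
  by have [] := Iz i.
exact: Ez.
Qed.

(** The complementarity products are zero, so strict signs on and off [A] determine which factor
    vanishes and imply the remaining inequalities. *)
Lemma kkt_of_res t (A : {set 'I_mI}) (p : triple) : kkt_res (pack p) t = 0 ->
  (forall i, i \in A -> 0 < p.1.2 i 0) ->
  (forall i, i \notin A -> ineq t i p.1.1 < 0) -> kkt t p.1.1 p.1.2 p.2.
Proof.
case: p => [[z nu] la] /=; rewrite /kkt_res !(col_mxKu, col_mxKd) /=.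
rewrite -!col_mx0 => /eq_col_mx[/eq_col_mx[st cs] eq] nupos Ineg.
have csi i : nu i 0 * ineq t i z = 0.
  by have := congr1 (fun M : 'cV_mI => M i 0) cs; rewrite !mxE.
split => // i.
  have [iA|iA] := boolP (i \in A).
    have /eqP := csi i; rewrite mulf_eq0 gt_eqF ?nupos//= => /eqP I0.
    by rewrite I0 mulr0; split => //; apply: ltW; apply: nupos.
  have /eqP := csi i; rewrite mulf_eq0 orbC lt_eqF ?Ineg//= => /eqP nu0.
  by rewrite nu0 mul0r; split => //; apply: ltW; apply: Ineg.
by have := congr1 (fun M : 'cV_mE => M i 0) eq; rewrite !mxE.
Qed.

Definition kkt_jac t (w1 w2 : 'cV[R]_(k + mI + mE)) : 'M[R]_(k + mI + mE) :=
  kkt_slope t (unpack w1).1.1 (unpack w1).1.2 (unpack w1).2 (unpack w2).1.1.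

Lemma kkt_jac_slope t w1 w2 :
  kkt_res w1 t - kkt_res w2 t = kkt_jac t w1 w2 *m (w1 - w2).
Proof. exact: kkt_res_slope. Qed.

Lemma kkt_res_cont w : continuous (kkt_res w : qcqp -> 'cV[R]_(k + mI + mE)).
Proof. by move=> t; apply: cvg_kkt_res; exact: cvg_id. Qed.

Lemma kkt_jac_cont (p : qcqp * 'cV[R]_(k + mI + mE) * 'cV[R]_(k + mI + mE)) :
  kkt_jac q.1.1 q.1.2 q.2 @[q --> p] --> kkt_jac p.1.1 p.1.2 p.2.
Proof.
have pc : q @[q --> p] --> p by exact: cvg_id.
have tc := cvg_fst_nbhs (cvg_fst_nbhs pc).
have w1c : unpack q.1.2 @[q --> p] --> unpack p.1.2.
  exact: cvg_unpack (cvg_snd_nbhs (cvg_fst_nbhs pc)).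
have w2c : unpack q.2 @[q --> p] --> unpack p.2.
  exact: cvg_unpack (cvg_snd_nbhs pc).
exact: (cvg_kkt_slope tc (cvg_fst_nbhs (cvg_fst_nbhs w1c))
  (cvg_snd_nbhs (cvg_fst_nbhs w1c)) (cvg_snd_nbhs w1c)
  (cvg_fst_nbhs (cvg_fst_nbhs w2c))).
Qed.

Lemma kkt_jac_diag t z nu la :
  kkt_jac t (pack (z, nu, la)) (pack (z, nu, la)) = kkt_mx t z nu la.
Proof. by rewrite /kkt_jac packK kkt_slope_diag. Qed.

Variables (t : qcqp) (z : 'cV[R]_k) (nu : 'cV[R]_mI) (la : 'cV[R]_mE).
Hypothesis t_sym : symmetric_params t.
Hypothesis t_kkt : kkt t z nu la.
Hypothesis scs : strict_complementarity t z nu.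
Hypothesis sosc : second_order_sufficient t z nu la.
Hypothesis M_unit : kkt_mx t z nu la \in unitmx.

Let w0 := pack (z, nu, la).

Let jac_unit : kkt_jac t w0 w0 \in unitmx.
Proof. by rewrite kkt_jac_diag. Qed.

Let res0 : kkt_res w0 t = 0.
Proof. exact: (@kkt_res0 t (z, nu, la)). Qed.

Lemma solution_map_exists : exists s, solution_map t z nu la s.
Proof.
have [s [st s_cont s_sol]] := implicit_function_exists
  (F := fun w => kkt_res w : {linear qcqp -> _}) kkt_res_cont kkt_jac_slope
  kkt_jac_cont res0 jac_unit.
have [r r0 s_uniq] := implicit_function_unique
  (F := fun w => kkt_res w : {linear qcqp -> _}) kkt_jac_slope
  kkt_jac_cont jac_unit.
have us_t : unpack (s t) = (z, nu, la) by rewrite st packK.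
have s_to : s t' @[t' --> t] --> w0 by rewrite -st.
have us_to : unpack (s t') @[t' --> t] --> (z, nu, la).
  by rewrite -us_t; exact: cvg_unpack.
have us_kkt : \forall t' \near t,
    kkt t' (unpack (s t')).1.1 (unpack (s t')).1.2 (unpack (s t')).2.
  have zc := cvg_fst_nbhs (cvg_fst_nbhs us_to).
  have nuc := cvg_snd_nbhs (cvg_fst_nbhs us_to).
  (* Strict complementarity makes active multipliers positive and inactive constraints negative at
     [t]; these strict inequalities persist along the continuous branch. *)
  near=> t'; apply: (@kkt_of_res _ (active t z)).
  - by rewrite unpackK; near: t'.
  - near: t'; apply: filter_forall => i.
    have [iA|iA] := boolP (i \in active t z); last by apply: nearW.
    have H : \forall x \near t, 0 < (unpack (s x)).1.2 i 0.
      exact: (cvgr_gt _ (cvg_entry (i := i) (j := 0) nuc) _ (scs.1 i iA)).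
    by apply: filterS H => x ? _.
  - near: t'; apply: filter_forall => i.
    have [iA|iA] := boolP (i \in active t z); first by apply: nearW.
    have I0 : ineq t i z < 0.
      have [_ Iz _] := t_kkt; have [Ii _ _] := Iz i.
      by rewrite lt_neqAle Ii andbT; move: iA; rewrite inE.
    have idc : t' @[t' --> t] --> t by exact: cvg_id.
    have H : \forall x \near t, ineq x i (unpack (s x)).1.1 < 0.
      exact: (cvgr_lt _ (cvg_ineq (i := i) idc zc) _ I0).
    by apply: filterS H => x ? _.
exists (unpack \o s); split => //.
- by rewrite /prop_for /continuous_at /= us_t.
- exists [set p | `|w0 - pack p| <= r].
    have idc : p @[p --> (z, nu, la)] --> (z, nu, la) by exact: cvg_id.
    have /cvgrPdist_le : pack p @[p --> (z, nu, la)] --> w0 by exact: cvg_pack idc.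
    exact.
  near=> t'.
  have sr : `|w0 - s t'| <= r.
    by near: t'; move/cvgrPdist_le : s_to; exact.
  split.
  + by rewrite /= unpackK.
  + by near: t'.
  + move=> p pr p_kkt; apply: (can_inj packK); rewrite /= unpackK.
    have uniq : forall w1 w2, `|w0 - w1| <= r -> `|w0 - w2| <= r ->
        kkt_res w1 t' = 0 -> kkt_res w2 t' = 0 -> w1 = w2 by near: t'.
    by apply: uniq => //; [exact: kkt_res0|near: t'].
- apply: (@strict_optimal_near _ _ _ _ t z nu la) => //; first exact: scs.1.
  by rewrite /prop_for /continuous_at /= us_t.
Unshelve. all: by end_near. Qed.

(** Continuity at [t] and a vanishing residual nearby suffice for [implicit_function_diff], so the
    formula applies to every solution map. *)
Lemma solution_map_diff s : solution_map t z nu la s ->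
  \forall t' \near t, is_diff t' (pack \o s)
    (fun h => - invmx (kkt_jac t' (pack (s t')) (pack (s t')))
              *m kkt_res (pack (s t')) h).
Proof.
move=> [st s_cont [V _ s_kkt] _].
have := @implicit_function_diff _ _ _
  (fun w => kkt_res w : {linear qcqp -> _}) kkt_jac kkt_res_cont kkt_jac_slope
  kkt_jac_cont t w0 jac_unit (pack \o s).
apply.
- by rewrite /= st.
- by apply: cvg_pack.
- by apply: filterS s_kkt => t' [_ /kkt_res0].
Qed.

Lemma diff_grad (l : 'cV[R]_k -> R) z' u : differentiable l z' ->
  'd l z' u = scal ((grad l z')^T *m u).
Proof.
move=> dl; rewrite /scal mxE {1}(matrix_sum_delta u) linear_sum /=.
apply: eq_bigr => i _; rewrite big_ord1 linearZ /= !mxE deriveE// mulrC.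
by [].
Qed.

Variables (l : 'cV[R]_k -> R) (s : qcqp -> triple).
Hypothesis l_diff : forall w, differentiable l w.
Hypothesis s_map : solution_map t z nu la s.

Let lz t' := l (s t').1.1.

Let lzE : lz = l \o (usubmx \o usubmx) \o (pack \o s).
Proof. by apply: funext => t'; rewrite /lz /= /pack !col_mxKu. Qed.

Let usub_cont : continuous
  (usubmx \o usubmx : 'cV[R]_(k + mI + mE) -> 'cV[R]_k).
Proof.
move=> w; have idc : x @[x --> w] --> w by exact: cvg_id.
exact: cvg_usubmx (cvg_usubmx idc).
Qed.

Let usub_diff w : differentiable
  (usubmx \o usubmx : 'cV[R]_(k + mI + mE) -> 'cV[R]_k) w.
Proof. exact: linear_differentiable. Qed.

Lemma loss_diff : \forall t' \near t, differentiable lz t'.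
Proof.
rewrite lzE; apply: filterS (solution_map_diff s_map) => t' ds.
apply: differentiable_comp; first exact: ex_diff.
by apply: differentiable_comp.
Qed.

(** The adjoint method: in [dl (- M^-1 F h)] the inverse is moved onto the gradient of the loss,
    giving one vector that serves every direction [h]. *)
Lemma loss_derive h : 'D_h lz t =
  scal ((- ((invmx (kkt_mx t z nu la))^T *m col_mx (col_mx (grad l z) 0) 0))^T
        *m kkt_res w0 h).
Proof.
have ds := nbhs_singleton (solution_map_diff s_map).
have [st _ _ _] := s_map; rewrite st kkt_jac_diag in ds.
have dl : differentiable l (usubmx (usubmx (pack (s t)))) by [].
rewrite deriveE; last exact: nbhs_singleton loss_diff.
rewrite lzE diff_comp; last 2 first.
- exact: ex_diff.
- by apply: differentiable_comp.
rewrite diff_comp//= diff_lin// (@diff_val _ _ _ _ _ _ _ ds) diff_grad//.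
rewrite /= st /= {1}/pack !col_mxKu.
set y := kkt_res _ _.
rewrite mulNmx !linearN /= mulNmx; congr (scal (- _)).
rewrite trmx_mul trmxK -mulmxA !tr_col_mx !trmx0.
(* The zero blocks of the padded gradient select the [z] component of [v]. *)
set v := invmx _ *m y; rewrite -[in RHS](vsubmxK v) -[in RHS](vsubmxK (usubmx v)).
by rewrite !mul_row_col !mul0mx !addr0.
Qed.

End SolutionBranch.

(** * Pairing the adjoint vector with elementary perturbations *)

Section Adjoint.
Context {R : realType} {k mI mE : nat}.
Notation qcqp := (qcqp R k mI mE).

Lemma scal_mul_delta (u : 'cV[R]_k) a : scal (u^T *m delta_mx a 0) = u a 0.
Proof. by rewrite -colE /scal !mxE. Qed.

Lemma scal_delta_mul (u v : 'cV[R]_k) a b :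
  scal (u^T *m delta_mx b a *m v) = u b 0 * v a 0.
Proof.
rewrite -(mul_delta_mx (0 : 'I_1)) mulmxA -colE -mulmxA -rowE /scal.
by rewrite mxE big_ord1 !mxE.
Qed.

Lemma quad_delta_mx (z : 'cV[R]_k) a b :
  quad (delta_mx b a) 0 0 z = 2^-1 * (z b 0 * z a 0).
Proof. by rewrite /quad scal_delta_mul trmx0 mul0mx /scal mxE !addr0. Qed.

Lemma quad_delta_cv (z : 'cV[R]_k) a : quad 0 (delta_mx a 0) 0 z = z a 0.
Proof.
rewrite /quad mulmx0 mul0mx /scal mxE mulr0 add0r addr0 -/(scal _) -scal_tr.
by rewrite trmx_mul trmxK scal_mul_delta.
Qed.

Lemma quad_cst (z : 'cV[R]_k) r : quad 0 0 r z = r.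
Proof. by rewrite /quad mulmx0 mul0mx trmx0 mul0mx /scal mxE mulr0 !add0r. Qed.

(* The contribution of one constraint, perturbed by (P, q, r), to the pairing of
   the adjoint vector d with the KKT residual. *)
Definition kkt_pairing (z dz : 'cV[R]_k) (x y : R) (P : 'M[R]_k) (q : 'cV[R]_k)
  (r : R) : R := x * scal (dz^T *m (P *m z + q)) + y * quad P q r z.

Lemma kkt_pairing0 z dz x y : kkt_pairing z dz x y 0 0 0 = 0.
Proof. by rewrite /kkt_pairing mul0mx addr0 mulmx0 quad_cst /scal mxE !mulr0 addr0. Qed.

Lemma kkt_pairing_mx z dz x y a b : kkt_pairing z dz x y (delta_mx b a) 0 0 =
  x * (dz b 0 * z a 0) + y * (2^-1 * (z b 0 * z a 0)).
Proof. by rewrite /kkt_pairing addr0 mulmxA scal_delta_mul quad_delta_mx. Qed.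

Lemma kkt_pairing_cv z dz x y a : kkt_pairing z dz x y 0 (delta_mx a 0) 0 =
  x * dz a 0 + y * z a 0.
Proof. by rewrite /kkt_pairing mul0mx add0r scal_mul_delta quad_delta_cv. Qed.

Lemma kkt_pairing_sc z dz x y r : kkt_pairing z dz x y 0 0 r = y * r.
Proof.
by rewrite /kkt_pairing mul0mx addr0 mulmx0 quad_cst /scal mxE mulr0 add0r.
Qed.

Lemma sum_kkt_pairing m z dz (x y : 'I_m -> R) (P : 'I_m -> 'M[R]_k) q r i :
  (forall j, j != i -> [/\ P j = 0, q j = 0 & r j = 0]) ->
  \sum_j kkt_pairing z dz (x j) (y j) (P j) (q j) (r j) =
  kkt_pairing z dz (x i) (y i) (P i) (q i) (r i).
Proof.
move=> PQR; rewrite (bigD1 i)//= big1 ?addr0// => j /PQR[-> -> ->].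
exact: kkt_pairing0.
Qed.

(** The complementarity row of the residual is [nu i 0] times the constraint, so the weight of an
    inequality's value is [nu i 0 * dnu i 0], against [dla i 0] for an equality. *)
Lemma kkt_res_pairing (z dz : 'cV[R]_k) (nu dnu : 'cV[R]_mI) (la dla : 'cV[R]_mE)
    P0 q0 P q r D h g :
  scal ((col_mx (col_mx dz dnu) dla)^T *m
        kkt_res (pack (z, nu, la)) (mk_qcqp P0 q0 P q r D h g)) =
  scal (dz^T *m (P0 *m z + q0))
  + \sum_i kkt_pairing z dz (nu i 0) (nu i 0 * dnu i 0) (P i) (q i) (r i)
  + \sum_i kkt_pairing z dz (la i 0) (dla i 0) (D i) (h i) (g i).
Proof.
set t := mk_qcqp _ _ _ _ _ _ _ _.
have EP i : parP t i = P i by rewrite /parP rowK mxvecK.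
have Eq i : parq t i = q i by rewrite /parq rowK trmxK.
have Er i : parr t i = r i by rewrite /parr mxE.
have ED i : parD t i = D i by rewrite /parD rowK mxvecK.
have Eh i : parh t i = h i by rewrite /parh rowK trmxK.
have Eg i : parg t i = g i by rewrite /parg mxE.
rewrite /kkt_res !(col_mxKu, col_mxKd) /= !tr_col_mx !mul_row_col !scalD.
rewrite !mulmxDr !scalD !mulmx_sumr !scal_sum.
rewrite /kkt_pairing !big_split /=.
have -> : scal (dnu^T *m \col_i (nu i 0 * ineq t i z)) =
    \sum_i nu i 0 * dnu i 0 * quad (P i) (q i) (r i) z.
  rewrite /scal mxE; apply: eq_bigr => i _.
  by rewrite !mxE /ineq EP Eq Er; ring.
have -> : scal (dla^T *m \col_i equa t i z) =
    \sum_i dla i 0 * quad (D i) (h i) (g i) z.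
  rewrite /scal mxE; apply: eq_bigr => i _.
  by rewrite !mxE /equa ED Eh Eg.
under eq_bigr do rewrite -scalemxAr scalZ EP Eq.
under [X in _ + X + _ + _ = _]eq_bigr do rewrite -scalemxAr scalZ ED Eh.
rewrite -!addrA; congr (_ + (_ + (_ + _))); rewrite addrCA.
by [].
Qed.

End Adjoint.

(** * The gradient formulas for all parameters *)

Unset Implicit Arguments.
Set Strict Implicit.

Theorem theorem1 (R : realType) (k mI mE : nat) (t : qcqp R k mI mE)
    (z : 'cV[R]_k) (nu : 'cV[R]_mI) (la : 'cV[R]_mE) (l : 'cV[R]_k -> R)
    (t_sym : symmetric_params t)
    (z_opt : optimal t z)
    (z_kkt : kkt t z nu la)
    (l_diff : forall w, differentiable l w)
    (scs : strict_complementarity t z nu)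
    (cq : licq t z)
    (sosc : second_order_sufficient t z nu la) :
  let M := kkt_mx t z nu la in
  let d := - ((invmx M)^T *m col_mx (col_mx (grad l z) 0) 0) in
  let dz : 'cV[R]_k := usubmx (usubmx d) in
  let dnu : 'cV[R]_mI := dsubmx (usubmx d) in
  let dla : 'cV[R]_mE := dsubmx d in
  [/\ M \in unitmx,
      exists s, solution_map t z nu la s &
      forall s, solution_map t z nu la s ->
      let lz := fun t' => l (s t').1.1 in
      [/\ \forall t' \near t, differentiable lz t',
          nabla_mx lz t (at_P0 mI mE) = z *m dz^T /\
          nabla_cv lz t (at_q0 mI mE) = dz,
          forall i : 'I_mI,
          [/\ nabla_mx lz t (at_P mE i)
                = nu i 0 *: (z *m dz^T)
                  + (2^-1 * nu i 0 * dnu i 0) *: (z *m z^T),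
              nabla_cv lz t (at_q mE i)
                = nu i 0 *: dz + (nu i 0 * dnu i 0) *: z &
              nabla_sc lz t (at_r k mE i) = nu i 0 * dnu i 0] &
          forall i : 'I_mE,
          [/\ nabla_mx lz t (at_D mI i)
                = la i 0 *: (z *m dz^T) + (2^-1 * dla i 0) *: (z *m z^T),
              nabla_cv lz t (at_h mI i) = la i 0 *: dz + dla i 0 *: z &
              nabla_sc lz t (at_g k mI i) = dla i 0]]].
Proof.
move=> M d dz dnu dla.
have M_unit : M \in unitmx by exact: kkt_mx_unit.
split => //; first exact: solution_map_exists.
move=> s s_map lz.
(* One formula covers all parameter slots; each gradient below specialises it to a basis
   perturbation, for which at most one summand survives. *)
have dlz P0 q0 P q r D h g : 'D_(mk_qcqp P0 q0 P q r D h g) lz t =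
    scal (dz^T *m (P0 *m z + q0))
    + \sum_i kkt_pairing z dz (nu i 0) (nu i 0 * dnu i 0) (P i) (q i) (r i)
    + \sum_i kkt_pairing z dz (la i 0) (dla i 0) (D i) (h i) (g i).
  by rewrite /lz (loss_derive M_unit l_diff s_map) -kkt_res_pairing !vsubmxK.
have sum0 m (x y : 'I_m -> R) : \sum_i kkt_pairing z dz (x i) (y i) 0 0 0 = 0.
  by rewrite big1 // => i _; rewrite kkt_pairing0.
have outer (u v : 'cV[R]_k) a b : (u *m v^T) a b = u a 0 * v b 0.
  by rewrite mxE big_ord1 mxE.
have outer2 (x y : R) (u v : 'cV[R]_k) a b :
    (x *: (z *m u^T) + y *: (z *m v^T)) a b =
    x * (z a 0 * u b 0) + y * (z a 0 * v b 0).
  by rewrite mxE; congr (_ + _); rewrite mxE outer.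
have scal0 : scal (dz^T *m (0 *m z + 0)) = 0.
  by rewrite mul0mx addr0 mulmx0 /scal mxE.
split; first exact (loss_diff M_unit l_diff s_map).
- split.
    (* Entry [(a, b)] is the derivative along [delta_mx b a], namely [dz b 0 * z a 0], which is why
       [z] stands on the left of the outer product. *)
    apply/matrixP => a b; rewrite mxE dlz !sum0 !addr0 mulmxA scal_delta_mul.
    by rewrite outer mulrC.
  apply/colP => a; rewrite mxE dlz !sum0 !addr0 mul0mx add0r.
  by rewrite scal_mul_delta.
- move=> i; split.
  + apply/matrixP => a b; rewrite mxE dlz sum0 addr0 scal0 add0r.
    rewrite (@sum_kkt_pairing _ _ _ _ _ _ _ _ _ _ i) => [|j /negbTE -> //].
    rewrite eqxx kkt_pairing_mx outer2.
    by ring.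
  + apply/colP => a; rewrite mxE dlz sum0 addr0 scal0 add0r.
    rewrite (@sum_kkt_pairing _ _ _ _ _ _ _ _ _ _ i) => [|j /negbTE -> //].
    by rewrite eqxx kkt_pairing_cv !mxE.
  + rewrite /nabla_sc dlz sum0 addr0 scal0 add0r.
    rewrite (@sum_kkt_pairing _ _ _ _ _ _ _ _ _ _ i) => [|j /negbTE -> //].
    by rewrite eqxx kkt_pairing_sc mulr1.
- move=> i; split.
  + apply/matrixP => a b; rewrite mxE dlz sum0 addr0 scal0 add0r.
    rewrite (@sum_kkt_pairing _ _ _ _ _ _ _ _ _ _ i) => [|j /negbTE -> //].
    rewrite eqxx kkt_pairing_mx outer2.
    by ring.
  + apply/colP => a; rewrite mxE dlz sum0 addr0 scal0 add0r.
    rewrite (@sum_kkt_pairing _ _ _ _ _ _ _ _ _ _ i) => [|j /negbTE -> //].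
    by rewrite eqxx kkt_pairing_cv !mxE.
  + rewrite /nabla_sc dlz sum0 addr0 scal0 add0r.
    rewrite (@sum_kkt_pairing _ _ _ _ _ _ _ _ _ _ i) => [|j /negbTE -> //].
    by rewrite eqxx kkt_pairing_sc mulr1.
Qed.
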